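(* Let $n$ and $l$ be positive integers, and let $A$ be an $l$-generated associative PI-algebra over a field satisfying an admissible polynomial identity of degree $n$. Then the height of $A$ over the set of words of length less than $n$ (in the generators) does not exceed $\Phi(n,l)$, where $$\Phi(n,l)=E_1\, l\cdot n^{E_2+12\log_3 n},\qquad E_1=4^{21\log_3 4+17},\qquad E_2=30\log_3 4+10.$$
   Context: A polynomial identity is called admissible if at least one of the coefficients of its terms of highest degree equals $1$. Words in $A$ are products of the fixed $l$ generators of $A$. A PI-algebra $A$ has bounded height $\mathrm{Ht}_Y(A)=h$ over a set of words $Y=\{u_1,u_2,\dots\}$ if $h$ is the least number such that every word $x$ of $A$ can be represented in $A$ as a finite linear combination $$x=\sum_i \alpha_i\, u_{j_{(i,1)}}^{k_{(i,1)}}u_{j_{(i,2)}}^{k_{(i,2)}}\cdots u_{j_{(i,r_i)}}^{k_{(i,r_i)}}$$ with scalars $\alpha_i$ and all $r_i\leqslant h$. *)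

(* Defs.v *)
From HB Require Import structures.
From mathcomp Require Import all_boot all_order all_algebra.
From mathcomp Require Import finmap monalg.
From mathcomp Require Import reals exp.

Set Implicit Arguments.
Unset Strict Implicit.
Unset Printing Implicit Defensive.

Import Order.TTheory GRing.Theory Num.Theory.

Local Open Scope ring_scope.

(* MathComp's algType is unital and nonzero. An associative algebra, possibly
   without unit and possibly zero, is given here by a K-module A together with
   a bilinear product mul; associativity of mul is assumed in the theorem. *)

Section AssociativeAlgebra.
Variables (K : fieldType) (A : lmodType K) (mul : {bilinear A -> A -> A}).

(* The product of a nonempty sequence. The empty product does not exist in a
   non-unital algebra; it gets the value 0, so that it contributes nothing to
   a linear combination. *)
Definition mprod (s : seq A) : A :=
  if s is x :: s' then foldl mul x s' else 0.

Definition power (x : A) (k : nat) : A := mprod (nseq k x).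

Definition generates (l : nat) (a : 'I_l -> A) : Prop :=
  forall B : A -> Prop,
    B 0 ->
    (forall x y, B x -> B y -> B (x + y)) ->
    (forall (c : K) x, B x -> B (c *: x)) ->
    (forall x y, B x -> B y -> B (mul x y)) ->
    (forall i, B (a i)) ->
  forall x, B x.

(* {malg K[{fmonom nat}]} is the free associative algebra on countably many
   variables. *)
Definition ncpoly_eval (v : nat -> A) (f : {malg K[{fmonom nat}]}) : A :=
  \sum_(m <- msupp f) f@_m *: mprod (map v m).

(* A polynomial identity of a non-unital algebra has no constant term. *)
Definition polynomial_identity (f : {malg K[{fmonom nat}]}) : Prop :=
  f@_mone = 0 /\ forall v : nat -> A, ncpoly_eval v f = 0.

Section Height.
Variables (l : nat) (a : 'I_l -> A).

Definition word_val (w : seq 'I_l) : A := mprod (map a w).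

(* x is a linear combination of products u_1^k_1 ... u_r^k_r with r <= h, all
   u_j in Y and all k_j > 0; a term is encoded as (alpha, [:: (u_1, k_1); ...]).
   Exponents 0 would only shorten the product. *)
Definition height_representation (Y : {pred seq 'I_l}) (h : nat) (x : A) :
    Prop :=
  exists c : seq (K * seq (seq 'I_l * nat)),
    (forall t, t \in c ->
       (size t.2 <= h)%N /\
       (forall p, p \in t.2 -> p.1 \in Y /\ (0 < p.2)%N)) /\
    x = \sum_(t <- c)
          t.1 *: mprod [seq power (word_val p.1) p.2 | p <- t.2].

Definition height_at_most (Y : {pred seq 'I_l}) (h : nat) : Prop :=
  forall w : seq 'I_l, w != [::] -> height_representation Y h (word_val w).

Definition has_height (Y : {pred seq 'I_l}) (h : nat) : Prop :=
  height_at_most Y h /\ forall h', height_at_most Y h' -> (h <= h')%N.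

End Height.

End AssociativeAlgebra.

Definition ncpoly_degree (K : fieldType) (f : {malg K[{fmonom nat}]}) : nat :=
  \max_(m <- msupp f) fdeg m.

Definition admissible (K : fieldType) (f : {malg K[{fmonom nat}]}) : Prop :=
  exists2 m, m \in msupp f & fdeg m = ncpoly_degree f /\ f@_m = 1.

Definition short_words (n l : nat) : {pred seq 'I_l} :=
  [pred w | (0 < size w < n)%N].
Arguments short_words : clear implicits.

Section Bound.
Variable R : realType.

Definition log3 (x : R) : R := ln x / ln 3.

Definition E1 : R := 4 `^ (21 * log3 4 + 17).

Definition E2 : R := 30 * log3 4 + 10.

Definition Phi (n l : nat) : R :=
  E1 * l%:R * n%:R `^ (E2 + 12 * log3 n%:R).

End Bound.

(* Main.v *)
Require Import Defs.
From HB Require Import structures.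
From mathcomp Require Import all_boot all_order all_algebra.
From mathcomp Require Import finmap monalg.
From mathcomp Require Import boolp reals exp.
From mathcomp Require Import zify ring lra.

Set Implicit Arguments.
Unset Strict Implicit.
Unset Printing Implicit Defensive.

Import Order.TTheory GRing.Theory Num.Theory.

(** The identity is made multilinear, y_1 ... y_n being a combination of the
    products of y_1, ..., y_n in other orders (multilinear_identity). Hence a
    word is a combination of lexicographically smaller ones as soon as it
    contains n disjoint factors which, from left to right, decrease strictly
    (straightening, divided_reducible). By induction on the lexicographic order
    it is enough to write every undivided word, one without such factors, as a
    product of few powers of words shorter than n.

    The maximal stretches of period q < n with at least 2n periods are covered
    by two powers each. They are few: n of them with the same period and the same end
    would be divided, whence a bound in terms of the number of factors of length n
    (event_fibre, size_all_events). The other positions, called free, are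
    covered letter by letter (tiling), so free positions have to be counted,
    and factors of length n as well. Both counts follow the same pattern.

    The positions in question are coloured so that suffixes do not decrease
    along a colour; the number of colours is the length of the longest strictly
    decreasing sequence of suffixes. That number is at most n^2 if suffixes are
    compared by their first n letters (truncated_width), and O(n^2), however
    many letters are compared, at free positions (perfree_width). Along a
    colour a prefix of length k changes only at its first occurrences, and the
    number of first occurrences for length 3k exceeds the one for length k at
    most by a factor of about the cube of the number of colours (tripling). So
    about log_3 n triplings bound the number of factors of length n by
    n^(6 log_3 n) up to a polynomial, and a second round leads from prefixes of
    length n to a length that exceeds the number of colours, with the same
    factor; this explains the term 12 log_3 n. Prefixes of that length are
    so few in a stretch without first occurrences that the stretch would have to
    be periodic (short_stable_run), and an undivided word has no 2n-th powers at
    free positions (power_divided). This bounds the free positions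
    (size_om_leq, tiling_bound).

    The delicate point is perfree_width: in a decreasing sequence of suffixes
    the places where they differ may lie far away, so that no disjoint factors
    are visible. If a long prefix is shared by many suffixes at nearby
    positions, then it is almost periodic, which free positions forbid
    (block_lcp, block_aperiodic). A scan from right to left (descent_divided)
    then gains a new factor for one of three chains every few steps: either the
    next suffix is separated from the last one within the space left, or the
    prefix is repeated, and two repetitions which do not form a period contain
    two different factors that can be repeated further on. *)

(** * Comparison of the suffixes of a text *)

Section Factors.
Variable x : nat -> nat.

Definition agree i j k := all (fun u => x (i + u) == x (j + u)) (iota 0 k).

(** The suffix at i exceeds the suffix at j, and t is the first place where they
    differ. *)
Definition gtat t i j := agree i j t && (x (j + t) < x (i + t)).

(** The comparison is decided within the first k letters, so that incomparable
    suffixes are those with a common prefix of length k. *)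
Definition wgt i j k := has (fun t => gtat t i j) (iota 0 k).

Lemma agreeP i j k :
  reflect (forall u, u < k -> x (i + u) = x (j + u)) (agree i j k).
Proof.
apply: (iffP allP) => [H u ltuk|H u].
  by apply/eqP/H; rewrite mem_iota add0n.
by rewrite mem_iota add0n => /andP[_ /H ->].
Qed.

Lemma wgtP i j k : reflect (exists2 t, t < k & gtat t i j) (wgt i j k).
Proof.
apply: (iffP hasP) => [[t]|[t ltk gt]].
  by rewrite mem_iota add0n => ltk gt; exists t.
by exists t => //; rewrite mem_iota add0n.
Qed.

Lemma agree_refl i k : agree i i k.
Proof. exact/agreeP. Qed.

Lemma agree_sym i j k : agree i j k -> agree j i k.
Proof. by move=> /agreeP H; apply/agreeP => u /H. Qed.

Lemma agree_trans i j m k : agree i j k -> agree j m k -> agree i m k.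
Proof.
by move=> /agreeP H1 /agreeP H2; apply/agreeP => u ltu; rewrite H1 ?H2.
Qed.

Lemma agree_leq i j k k' : k' <= k -> agree i j k -> agree i j k'.
Proof.
by move=> lek /agreeP H; apply/agreeP => u ltu; apply: H; apply: leq_trans lek.
Qed.

Lemma agree_shift i j k s : s <= k -> agree i j k -> agree (i + s) (j + s) (k - s).
Proof.
by move=> les /agreeP H; apply/agreeP => u ltu; rewrite -!addnA H //; lia.
Qed.

Lemma agree_cat i j k k' :
  agree i j k -> agree (i + k) (j + k) k' -> agree i j (k + k').
Proof.
move=> /agreeP H1 /agreeP H2; apply/agreeP => u ltu.
case: (ltnP u k) => [/H1 //|leku].
have := H2 (u - k); rewrite -!addnA subnKC //; apply; lia.
Qed.

Lemma wgt_leq i j k k' : k <= k' -> wgt i j k -> wgt i j k'.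
Proof.
by move=> lek /wgtP[t ltk gt]; apply/wgtP; exists t => //; apply: leq_trans lek.
Qed.

Lemma gtat_wgt t i j k : t < k -> gtat t i j -> wgt i j k.
Proof. by move=> ltk gt; apply/wgtP; exists t. Qed.

Lemma gtat_trans s t i j m : gtat s i j -> gtat t j m -> gtat (minn s t) i m.
Proof.
move=> /andP[/agreeP A1 lt1] /andP[/agreeP A2 lt2]; apply/andP; split.
  by apply/agreeP => u; rewrite leq_min => /andP[us ut]; rewrite A1 ?A2.
case: (ltngtP s t) => [lst|lts|est]; first by rewrite -A2.
  by rewrite A1.
by rewrite est in lt1 *; apply: ltn_trans lt2 lt1.
Qed.

Lemma wgt_trans i j m k : wgt i j k -> wgt j m k -> wgt i m k.
Proof.
move=> /wgtP[s lts gs] /wgtP[t ltt gt]; apply: gtat_wgt (gtat_trans gs gt).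
by rewrite gtn_min lts.
Qed.

Lemma gtat_agree_leq t i j k : gtat t i j -> agree i j k -> k <= t.
Proof.
move=> /andP[_ lt] /agreeP A; case: leqP => // /A eqx.
by rewrite eqx ltnn in lt.
Qed.

Lemma agree_nwgt i j k : agree i j k -> ~~ wgt i j k.
Proof.
move=> A; apply/wgtP => -[t ltk /gtat_agree_leq/(_ A)].
by rewrite leqNgt ltk.
Qed.

Lemma wgt_total i j k : [|| agree i j k, wgt i j k | wgt j i k].
Proof.
case: (boolP (agree i j k)) => //= NA.
have exu : exists u, (u < k) && (x (i + u) != x (j + u)).
  case/allPn: NA => u; rewrite mem_iota add0n => /andP[_ ltu] neq.
  by exists u; rewrite ltu.
have [u /andP[ltu neq] min_u] := ex_minnP exu.
have A : agree i j u.
  apply/agreeP => v ltv; apply/eqP/negPn/negP => neqv.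
  have := min_u v; rewrite neqv (ltn_trans ltv ltu) => /(_ isT).
  by rewrite leqNgt ltv.
apply/orP; move: neq; rewrite neq_ltn => /orP[lt|lt]; [right|left].
  by apply: (gtat_wgt ltu); rewrite /gtat agree_sym.
by apply: (gtat_wgt ltu); rewrite /gtat A.
Qed.

Lemma wgt_asym i j k : wgt i j k -> ~~ wgt j i k.
Proof.
move=> gij; apply/negP => gji.
by have := agree_nwgt (agree_refl i k); rewrite (wgt_trans gij gji).
Qed.

Lemma agree_wgtl i j m k : agree i j k -> wgt j m k -> wgt i m k.
Proof.
move=> /agreeP A /wgtP[t ltk /andP[/agreeP A' lt]]; apply: (gtat_wgt ltk).
apply/andP; split; last by rewrite A.
by apply/agreeP => u ltu; rewrite A ?A' // (ltn_trans ltu).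
Qed.

Lemma agree_wgtr i j m k : agree j m k -> wgt i j k -> wgt i m k.
Proof.
move=> /agreeP A /wgtP[t ltk /andP[/agreeP A' lt]]; apply: (gtat_wgt ltk).
apply/andP; split; last by rewrite -A.
by apply/agreeP => u ltu; rewrite A' ?A // (ltn_trans ltu).
Qed.

(** Lexicographic order has convex prefix classes. *)
Lemma agree_sandwich i j m k :
  ~~ wgt j i k -> ~~ wgt m j k -> agree i m k -> agree i j k.
Proof.
move=> nji nmj A; have := wgt_total i j k; rewrite (negPf nji) orbF.
case/orP => // gij.
by have := agree_wgtl (agree_sym A) gij; rewrite (negPf nmj).
Qed.

Lemma agree_gtat_find i j k : ~~ agree i j k ->
  exists t, [/\ t < k, agree i j t & x (i + t) != x (j + t)].
Proof.
move=> NA; have := wgt_total i j k; rewrite (negPf NA) /=.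
by case/orP => /wgtP[t ltk /andP[A lt]]; exists t; split=> //;
  rewrite ?(agree_sym A) // neq_ltn lt ?orbT.
Qed.

Definition factor i k := mkseq (fun u => x (i + u)) k.

Lemma factor_agree i j k : (factor i k == factor j k) = agree i j k.
Proof.
apply/eqP/agreeP => [e u ltu|H]; last first.
  by apply/eq_in_map => u; rewrite mem_iota add0n => /andP[_ /H].
by have := congr1 (nth 0 ^~ u) e; rewrite !nth_mkseq.
Qed.

(** Factors of the text are named by pairs (position, length). The first place
    where two consecutive factors of a chain differ lies inside both, so that
    the inequality survives whatever is appended to the factors. *)
Definition follows (I J : nat * nat) :=
  (I.1 + I.2 <= J.1) && wgt I.1 J.1 (minn I.2 J.2).

(** Shirshov's n-divisibility: n disjoint factors, from left to right, each
    exceeding the next. *)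
Definition divided N n := exists s : seq (nat * nat),
  [/\ size s = n, sorted follows s & all (fun I => I.1 + I.2 <= N) s].

Lemma divided_geq N n s : n <= size s -> sorted follows s ->
  all (fun I => I.1 + I.2 <= N) s -> divided N n.
Proof.
move=> les srt al; exists (take n s); split; first by rewrite size_takel.
  exact: take_sorted.
by move/allP: al => al; apply/allP => I /mem_take /al.
Qed.

Lemma divided_mkseq N n (f : nat -> nat * nat) :
  (forall j, j.+1 < n -> follows (f j) (f j.+1)) ->
  (forall j, j < n -> (f j).1 + (f j).2 <= N) -> divided N n.
Proof.
move=> ff fN; exists (mkseq f n); split; first exact: size_mkseq.
  apply/(sortedP (0, 0)) => j; rewrite size_mkseq => ltj.
  by rewrite !nth_mkseq ?ff // ltnW.
apply/allP => I /mapP[j]; rewrite mem_iota add0n => /andP[_ ltj] ->.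
exact: fN.
Qed.

Lemma follows_trans : transitive follows.
Proof.
move=> J I L; rewrite /follows => /andP[le1 g1] /andP[le2 g2].
have [s] := wgtP _ _ _ g1; rewrite leq_min => /andP[s1 s2] gs.
have [t] := wgtP _ _ _ g2; rewrite leq_min => /andP[t1 t2] gt.
apply/andP; split; first by lia.
by apply: gtat_wgt (gtat_trans gs gt); rewrite leq_min !gtn_min s1 t2 orbT.
Qed.

End Factors.

(** * Descents along aperiodic positions *)

(** Inside a factor of length dep that starts at c, the factors at c and at
    c + off agree in exactly lcp letters. Only these numbers matter, so the same
    node can be read at every later position with the same prefix. *)
Record node := Node { dep : nat; off : nat; lcp : nat }.

Section Scan.
Variables (x : nat -> nat) (E : nat).

Definition word c n := (c + off n, (lcp n).+1).

(** Chains grow at the left end: the next factor has to end no later than s. *)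
Definition chain_in s l :=
  [&& sorted (follows x) l, all (fun I => I.1 + I.2 <= E) l
    & if l is J :: _ then s <= J.1 else true].

(** The prefix of length m at c exceeds the first factor of the chain, hence all
    of them. *)
Definition dominates c m (l : seq (nat * nat)) :=
  if l is J :: _ then wgt x c J.1 (minn m J.2) else true.

Definition up_node c n :=
  (off n + lcp n < dep n) && gtat x (lcp n) (c + off n) c.

Definition down_node c n :=
  (off n + lcp n < dep n) && gtat x (lcp n) c (c + off n).

(** Read at one position, a node and the one under it on the stack occupy
    disjoint places, the lower one on the left. *)
Definition under n m := (dep m <= lcp n) && (dep m <= off n).

Definition stack_ok c y st :=
  all (fun n => (dep n <= y) && up_node c n) st && sorted under st.

Definition place c := foldl (fun l n => word c n :: l).

(** The factor of the lower node exceeds the prefix at c within dep m letters,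
    where the factor of n still agrees with that prefix. *)
Lemma under_follows c n m :
  up_node c n -> up_node c m -> under n m -> follows x (word c m) (word c n).
Proof.
move=> /andP[ln /andP[An gn]] /andP[lm /andP[Am gm]] /andP[l1 l2].
apply/andP; split; first by rewrite /=; lia.
apply: (@gtat_wgt _ (lcp m)); first by rewrite /= leq_min leqnn /=; lia.
apply/andP; split; last by rewrite (agreeP _ _ _ _ An) //; lia.
apply: (agree_trans Am); apply: agree_sym; apply: agree_leq An; lia.
Qed.

(** All nodes of a stack can be read at the same c. They form a chain whose
    leftmost factor comes from the bottom of the stack. *)
Lemma placeP c y st l : c + y <= E -> stack_ok c y st ->
  sorted (follows x) l -> all (fun I => I.1 + I.2 <= E) l ->
  (if l is J :: _ then if st is n :: _ then follows x (word c n) J else true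
   else true) ->
  [/\ sorted (follows x) (place c l st),
      all (fun I => I.1 + I.2 <= E) (place c l st),
      size (place c l st) = size st + size l
    & place c l st = if st is n :: st' then
        word c (last n st') :: behead (place c l st) else l].
Proof.
move=> leE; elim: st l => [|n st IH] l // /andP[/= /andP[/andP[ly un] al] pst].
move=> srt all_l hd.
have ok : stack_ok c y st by rewrite /stack_ok al (path_sorted pst).
have srt' : sorted (follows x) (word c n :: l).
  by case: l hd srt {all_l} => //= I l -> ->.
have all' : all (fun I => I.1 + I.2 <= E) (word c n :: l).
  rewrite /= all_l andbT; case/andP: un; lia.
have hd' : if st is m :: _ then follows x (word c m) (word c n) else true.
  case: st pst al {IH ok} => //= m st /andP[nm _] /andP[/andP[_ um] _].
  exact: under_follows.
have [] := IH _ ok srt' all'; first by case: st hd' {IH ok pst al}.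
move=> -> -> -> eqp; split=> //; first by rewrite /= addnS.
by rewrite {1}eqp; case: st {IH ok pst al hd' eqp}.
Qed.

Lemma under_low c n st : all (up_node c) st -> path under n st ->
  all (fun m => dep m <= lcp n) st.
Proof.
elim: st n => //= m st IH n /andP[/andP[lm _] al] /andP[/andP[l1 _] pst].
by rewrite l1 /=; apply: sub_all (IH _ al pst) => k; lia.
Qed.

(** If the next position exceeds c at the d-th letter, it also exceeds the factors
    whose nodes have d < lcp, so these are released at c; nodes with dep <= d
    are carried along. The nodes are nested, hence at most one is of neither
    kind. *)
Lemma pop c y st d : stack_ok c y st ->
  exists st1 lost st2, [/\ st = st1 ++ lost ++ st2, size lost <= 1,
    all (fun n => d < lcp n) st1 & all (fun n => dep n <= d) st2].
Proof.
elim: st => [|n st IH]; first by exists [::], [::], [::].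
move=> /andP[/= /andP[/andP[ly un] al] pst].
have ok : stack_ok c y st by rewrite /stack_ok al (path_sorted pst).
have [ltd|led] := ltnP d (lcp n).
  have [st1 [lost [st2 [-> sl a1 a2]]]] := IH ok.
  by exists (n :: st1), lost, st2; split; rewrite //= ltd.
have low : all (fun m => dep m <= d) st.
  have au : all (up_node c) st by apply: sub_all al => k /andP[].
  by apply: sub_all (under_low au pst) => m lem; apply: leq_trans led.
by exists [::], [:: n], st.
Qed.

Lemma up_node_agree a c m n :
  agree x a c m -> dep n <= m -> up_node c n -> up_node a n.
Proof.
move=> A le_m /andP[lt_n g]; rewrite /up_node lt_n /=.
have A1 : agree x a c (lcp n).+1 by apply: agree_leq A; lia.
have A2 : agree x (a + off n) (c + off n) (lcp n).+1.
  by apply: agree_leq (agree_shift _ A); lia.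
move/andP: g => [A3 lt]; apply/andP; split.
  apply: (agree_trans (agree_leq (leqnSn _) A2)); apply: (agree_trans A3).
  exact: agree_sym (agree_leq (leqnSn _) A1).
by rewrite (agreeP _ _ _ _ A1) // (agreeP _ _ _ _ A2).
Qed.

Lemma down_node_agree a c m n :
  agree x a c m -> dep n <= m -> down_node c n -> down_node a n.
Proof.
move=> A le_m /andP[lt_n g]; rewrite /down_node lt_n /=.
have A1 : agree x a c (lcp n).+1 by apply: agree_leq A; lia.
have A2 : agree x (a + off n) (c + off n) (lcp n).+1.
  by apply: agree_leq (agree_shift _ A); lia.
move/andP: g => [A3 lt]; apply/andP; split.
  apply: (agree_trans (agree_leq (leqnSn _) A1)); apply: (agree_trans A3).
  exact: agree_sym (agree_leq (leqnSn _) A2).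
by rewrite (agreeP _ _ _ _ A1) // (agreeP _ _ _ _ A2).
Qed.

Lemma dominates_gt a c d m m' l :
  gtat x d a c -> d < m' -> dominates c m l -> dominates a m' l.
Proof.
case: l => //= J _ gd ltd /wgtP[t]; rewrite leq_min => /andP[t1 t2] gt.
by apply: gtat_wgt (gtat_trans gd gt); rewrite leq_min !gtn_min ltd t2 orbT.
Qed.

Lemma dominates_agree a c m l :
  agree x a c m -> dominates c m l -> dominates a m l.
Proof.
case: l => //= J _ A; apply: agree_wgtl; apply: agree_leq A; exact: geq_minl.
Qed.

Lemma dominates_leq c m m' l : m <= m' -> dominates c m l -> dominates c m' l.
Proof. by case: l => //= J _ lem; apply: wgt_leq; lia. Qed.

Lemma chain_in_leq s s' l : s' <= s -> chain_in s l -> chain_in s' l.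
Proof.
move=> les /and3P[h1 h2 h3]; apply/and3P; split=> //.
by case: l h3 {h1 h2} => // J _; apply: leq_trans.
Qed.

Lemma chain_in_cons s p m l :
  s <= p -> p + m <= E -> chain_in (p + m) l ->
  (if l is J :: _ then wgt x p J.1 (minn m J.2) else true) ->
  chain_in s ((p, m) :: l).
Proof.
move=> les leE /and3P[h1 h2 h3] h4; apply/and3P; split=> //=; last first.
  by rewrite leE.
by case: l h1 h3 h4 {h2} => //= J l -> le1; rewrite /follows /= le1 => ->.
Qed.

Lemma stack_ok_agree a c d y y' st :
  agree x a c d -> d <= y' -> all (fun n => dep n <= d) st ->
  stack_ok c y st -> stack_ok a y' st.
Proof.
move=> A le_d al /andP[ok srt]; rewrite /stack_ok srt andbT.
elim: st al ok {srt} => //= n st IH /andP[le_n al] /andP[/andP[_ un] ok].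
rewrite (IH al ok) andbT (leq_trans le_n le_d) /=.
exact: up_node_agree A le_n un.
Qed.

Lemma stack_ok_cat c y s1 s2 :
  stack_ok c y (s1 ++ s2) -> stack_ok c y s1 && stack_ok c y s2.
Proof.
rewrite /stack_ok all_cat => /andP[/andP[-> ->]].
by case/cat_sorted2=> -> ->.
Qed.

(** State of a scan that has made j steps to the left, from b 0 to c. Three
    chains are under construction, all of them exceeded by the prefix of length
    y at c. In l1 are the factors between successful steps, in l2 those of
    pending nodes, in l3 those released from the stack. A node on the stack st
    exceeds the prefix at c and can be read again wherever this prefix is
    repeated. A pending node pd is exceeded by the prefix; it is read at the
    next repetition, where it joins l2. The flag pv records that the prefix of
    length y has just been repeated and still stands before e. The last
    condition charges the steps to the lengths of the chains. *)
Inductive inv j c : Prop := Inv e y l1 l2 l3 st pd (pv : bool) of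
  c < e <= E & 0 < y <= e - c
  & (if pv then agree x c (e - y) y && (c + y + y <= e) else y == e - c)
  & (if pd is Some n then
       [&& ~~ pv, dep n <= y, down_node c n & dominates c (lcp n) l2]
     else true)
  & chain_in e l1 && dominates c y l1
  & chain_in c l2 && dominates c y l2
  & chain_in e l3 && dominates c y l3
  & stack_ok c y st
  & j <= 6 * size l1 + 2 * size l2 + 2 * (size l3 + size st)
         + 2 * isSome pd + pv.

(** Releasing the nodes st1 at c keeps a chain, because the first factor of l3 is
    below the prefix at c, and every node on the stack is above it. *)
Lemma popped_chain e c y d st1 l3 :
  c + y <= e <= E -> stack_ok c y st1 -> chain_in e l3 -> dominates c y l3 ->
  [/\ chain_in c (place c l3 st1),
      size (place c l3 st1) = size st1 + size l3
    & forall a m, d < m -> gtat x d a c -> all (fun n => d < lcp n) st1 ->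
        dominates a m (place c l3 st1)].
Proof.
move=> /andP[le_y le_e] ok1 c3 d3.
have hd : is_true (if l3 is J :: _ then
            if st1 is n :: _ then follows x (word c n) J else true else true).
  case: l3 c3 d3 => // J l3 /and3P[_ _ le_J] dJ.
  case: st1 ok1 => // n st1 /andP[/= /andP[/andP[len un] _] _].
  have [ltn gn] := andP un.
  have [t] := wgtP _ _ _ _ dJ; rewrite leq_min => /andP[t1 t2] gt.
  apply/andP; split; first by rewrite /=; lia.
  apply: gtat_wgt (gtat_trans gn gt).
  by rewrite /= leq_min !gtn_min leqnn t2 orbT.
have leE : c + y <= E by lia.
have [srt3 ends3 _] := and3P c3.
have [s3 e3 sz3 eq3] := placeP leE ok1 srt3 ends3 hd.
clear hd srt3 ends3.
split=> // [|a m ltd gd a1].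
  apply/and3P; split=> //; rewrite eq3.
  case: st1 {ok1 s3 e3 sz3 eq3} => [|n st1]; last exact: leq_addr.
  by case: l3 c3 {d3} => // J l3 /and3P[_ _]; lia.
rewrite eq3; case: st1 a1 ok1 {s3 e3 sz3 eq3} => [|n st1] a1 ok1.
  exact: dominates_gt gd ltd d3.
have [lt_dl up_l] : d < lcp (last n st1) /\ up_node c (last n st1).
  case/andP: ok1 => ok1 _; elim: st1 n a1 ok1 => [|m' st1 IH] n /=.
    by rewrite !andbT => -> /andP[_ ->].
  by move=> /andP[_ a1] /andP[_ ok1]; apply: IH.
apply: (gtat_wgt (t := d)); first by rewrite leq_min /=; lia.
have [lA _] := andP (proj2 (andP up_l)).
have [A' lt'] := andP gd.
apply/andP; split.
  by apply: agree_trans A' _; apply: agree_sym; apply: agree_leq lA; lia.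
by rewrite (agreeP _ _ _ _ lA).
Qed.

(** The prefix at a exceeds the one at c inside both [a, c) and [c, e), so the
    factor [c, e) joins l1. The weight 6 of this factor pays for the step, for
    the node which the stack may lose, and for a pending node or a recorded
    repetition. *)
Lemma inv_success j a c d e y l1 l2 l3 st (k : nat) :
  c < e <= E -> 0 < y <= e - c -> d < c - a -> d < e - c -> gtat x d a c ->
  chain_in e l1 && dominates c y l1 -> chain_in c l2 && dominates c y l2 ->
  chain_in e l3 && dominates c y l3 -> stack_ok c y st -> k <= 3 ->
  j <= 6 * size l1 + 2 * size l2 + 2 * (size l3 + size st) + k ->
  inv j.+1 a.
Proof.
move=> he hy ltd lt_d gd.
have [ece ltaca leac leE] : [/\ c + (e - c) = e, 0 < c - a <= c - a, a < c
    & c <= E] by split; lia.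
have [hye hca] : c + y <= e <= E /\ a < c <= E by lia.
move=> /andP[c1 d1] /andP[c2 d2] /andP[c3 d3] hst lek hj.
have [st1 [lost [st2 [est s_lost a1 a2]]]] := pop d hst.
have [ok1 ok2] : stack_ok c y st1 /\ stack_ok c y st2.
  move: hst; rewrite est => /stack_ok_cat/andP[-> /stack_ok_cat/andP[_ ->]].
  by [].
have [h1 h2 h3] := popped_chain d hye ok1 c3 d3.
apply: (@Inv j.+1 a c (c - a) ((c, e - c) :: l1) l2 (place c l3 st1) st2
          None false) => //=.
- apply/andP; split; last first.
    by apply: (gtat_wgt (t := d)) gd; rewrite leq_min ltd lt_d.
  apply: chain_in_cons => //; rewrite ?ece //; first by case/andP: hye.
  have ley : y <= e - c by case/andP: hy.
  case: l1 c1 d1 {hj} => //= J l1 _; apply: wgt_leq.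
  by rewrite leq_min geq_minr (leq_trans (geq_minl _ _)).
- rewrite (chain_in_leq _ c2) /=; last exact: ltnW.
  exact: dominates_gt gd ltd d2.
- by rewrite h1 (h3 _ _ ltd gd a1).
- case/andP: gd => A _; apply: stack_ok_agree A (ltnW ltd) a2 ok2.
- rewrite h2; move: hj; rewrite est !size_cat; move: s_lost lek; clear; lia.
Qed.

(** The factor [c, e) is repeated at a, which is recorded by the flag. A pending
    node is not deeper than e - c, so it can be read at a and joins l2. *)
Lemma inv_fail1 j a c e l1 l2 l3 st pd :
  a < c -> c < e <= E -> e - c < c - a -> agree x a c (e - c) ->
  (if pd is Some n then
     [&& dep n <= e - c, down_node c n & dominates c (lcp n) l2]
   else true) ->
  chain_in e l1 && dominates c (e - c) l1 ->
  chain_in c l2 && dominates c (e - c) l2 ->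
  chain_in e l3 && dominates c (e - c) l3 -> stack_ok c (e - c) st ->
  j <= 6 * size l1 + 2 * size l2 + 2 * (size l3 + size st)
         + 2 * isSome pd ->
  inv j.+1 a.
Proof.
move=> lt_ac he hs A hpd /andP[c1 d1] /andP[c2 d2] /andP[c3 d3] hst hj.
have [hae hye he2 ecc hle] : [/\ a < e <= E, 0 < e - c <= e - a,
    a + (e - c) + (e - c) <= e, e - (e - c) = c & a + (e - c) <= c].
  by move: lt_ac he hs; clear; split; lia.
pose l2' := if pd is Some n then word a n :: l2 else l2.
have [hc2 hd2] : chain_in a l2' /\ dominates a (e - c) l2'.
  rewrite /l2'; case: pd hpd {hj l2'} => [n|_]; last first.
    by rewrite (chain_in_leq _ c2) ?(dominates_agree A) // ltnW.
  move=> /and3P[le_n dn dom]; have := down_node_agree A le_n dn.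
  have domA : dominates a (lcp n) l2.
    apply: dominates_agree dom; apply: agree_leq A.
    by case/andP: dn le_n; clear; lia.
  move=> /andP[lt_n gn]; split; last first.
    rewrite /=; apply: gtat_wgt gn; rewrite leq_min leqnn andbT.
    by move: lt_n le_n; clear; lia.
  have le_c : a + off n + (lcp n).+1 <= c.
    by move: lt_n le_n hle; clear; lia.
  apply: chain_in_cons; first exact: leq_addr.
  - by move: le_c he; clear; lia.
  - exact: chain_in_leq c2.
  - case: l2 domA {c2 d2 dom le_c} => //= J l2 dJ.
    have [A' _] := andP gn; apply: (wgt_leq (k := minn (lcp n) J.2)).
      by clear; lia.
    apply: agree_wgtl dJ; apply: agree_sym; apply: agree_leq A'.
    exact: geq_minl.
apply: (@Inv j.+1 a e (e - c) l1 l2' l3 st None true) => //.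
- by rewrite ecc A.
- by rewrite c1 (dominates_agree A).
- by rewrite hc2.
- by rewrite c3 (dominates_agree A).
- have low : all (fun n => dep n <= e - c) st.
    by case/andP: hst => ok _; apply: sub_all ok => n /andP[].
  exact: stack_ok_agree A (leqnn _) low hst.
- by move: hj; rewrite /l2'; case: (pd) => [n|] /=; clear; lia.
Qed.

(** The prefix of length y occurs at a, at c and once more at e - y, but
    g = e - y - c is not a period of [a, e). Hence the factors at a and a + g
    agree in t >= y letters and then differ inside [a, e). If the factor at
    a + g is larger, then this is a node for the stack; if it is smaller, the
    node becomes pending. *)
Lemma inv_fail2 j a c e y l1 l2 l3 st :
  a < c -> c < e <= E -> e - c < c - a -> agree x a c (e - c) ->
  (forall g, 0 < g <= e - c -> ~~ agree x a (a + g) (e - a - g)) ->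
  0 < y -> c + y + y <= e -> agree x c (e - y) y ->
  chain_in e l1 && dominates c y l1 -> chain_in c l2 && dominates c y l2 ->
  chain_in e l3 && dominates c y l3 -> stack_ok c y st ->
  j <= 6 * size l1 + 2 * size l2 + 2 * (size l3 + size st) + 1 ->
  inv j.+1 a.
Proof.
move=> lt_ac he hs A aper y_gt0 le_y A0.
move=> /andP[c1 d1] /andP[c2 d2] /andP[c3 d3] hst hj.
pose g := e - y - c.
have [gb gy hae hea [ley ley' cg gle]] : [/\ 0 < g <= e - c, y <= g,
    a < e <= E, 0 < e - a <= e - a & [/\ y <= e - c, y <= e - a, c + g = e - y
    & g <= e - c] ].
  by move: lt_ac he hs y_gt0 le_y; rewrite /g; clear; split; [| | | |split]; lia.
have Ay : agree x a c y by apply: agree_leq A.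
have [t [lt_t At neq_t]] := agree_gtat_find (aper g gb).
have le_yt : y <= t.
  rewrite leqNgt; apply/negP => lt_ty.
  have := agree_shift gle A; rewrite cg => /agreeP/(_ t) eq1.
  have e1 : x (a + g + t) = x (e - y + t).
    by apply: eq1; move: lt_ty le_y cg; rewrite /g; clear; lia.
  move: neq_t; rewrite e1 (agreeP _ _ _ _ Ay) // (agreeP _ _ _ _ A0) //.
  by rewrite eqxx.
have low : all (fun n => dep n <= y) st.
  by case/andP: hst => ok _; apply: sub_all ok => n /andP[].
have ok_a : stack_ok a (e - a) st.
  by apply: stack_ok_agree Ay ley' low hst.
have dom l : dominates c y l -> dominates a (e - a) l.
  by move=> /(dominates_agree Ay)/dominates_leq; apply.
have lt_gt : g + t < e - a by move: lt_t; clear; lia.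
move: neq_t; rewrite neq_ltn => /orP[lt_x|lt_x].
- apply: (@Inv j.+1 a e (e - a) l1 l2 l3 (Node (e - a) g t :: st) None false)
    => //.
  + by rewrite c1 dom.
  + by rewrite (chain_in_leq _ c2) ?dom // ltnW.
  + by rewrite c3 dom.
  + case/andP: ok_a => ok srt; apply/andP; split.
      by rewrite /= leqnn /up_node /= lt_gt /gtat agree_sym //= lt_x.
    case: st low srt {hst ok hj} => //= n st /andP[len _] ->.
    by rewrite /under /= !(leq_trans len).
  + by move: hj => /=; clear; lia.
- apply: (@Inv j.+1 a e (e - a) l1 l2 l3 st (Some (Node (e - a) g t)) false)
    => //.
  + rewrite /= leqnn /down_node /= lt_gt /gtat At lt_x /=.
    by apply: dominates_leq le_yt _; apply: dominates_agree Ay _.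
  + by rewrite c1 dom.
  + by rewrite (chain_in_leq _ c2) ?dom // ltnW.
  + by rewrite c3 dom.
  + by move: hj => /=; clear; lia.
Qed.

Lemma inv_step j a c d : a < c ->
  d < c - a -> gtat x d a c ->
  (forall e g, c < e <= E -> agree x a c (e - c) -> 0 < g <= e - c ->
     ~~ agree x a (a + g) (e - a - g)) ->
  inv j c -> inv j.+1 a.
Proof.
move=> lt_ac ltd gd aper [e y l1 l2 l3 st pd pv he hy hpv hpd h1 h2 h3 hst hj].
have [lt_d|ge_d] := ltnP d (e - c).
  apply: (inv_success he hy ltd lt_d gd h1 h2 h3 hst (k := 2 * isSome pd + pv)).
    by case: (pd) (pv) hpd => [n|] [].
  by rewrite addnA.
have A : agree x a c (e - c) by case/andP: gd => A _; exact: agree_leq A.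
have hs : e - c < c - a by apply: leq_ltn_trans ltd.
case: pv hpv hpd hj => [/andP[A0 le_y]|/eqP ey] hpd hj.
  case: pd hpd hj => // _ hj.
  apply: (inv_fail2 lt_ac he hs A _ _ le_y A0 h1 h2 h3 hst) => //.
  - by move=> g; apply: aper.
  - by case/andP: hy.
  - by move: hj; rewrite muln0 addn0.
rewrite ey in h1 h2 h3 hst hpd.
apply: (inv_fail1 lt_ac he hs A _ h1 h2 h3 hst (pd := pd)).
  by case: pd hpd {hj}.
by rewrite addn0 in hj.
Qed.

(** If none of l1, l2 and the released stack on top of l3 had n factors, then
    the number of steps would be at most 6(n-1) + 2(n-1) + 2(n-1) + 3 < 10n. *)
Lemma inv_divided j c n : inv j c -> 10 * n <= j -> 0 < n -> divided x E n.
Proof.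
case=> e y l1 l2 l3 st pd pv he hy _ _ /andP[c1 _] /andP[c2 _] /andP[c3 d3].
move=> hst hj hn n_gt0.
have [le1|lt1] := leqP n (size l1).
  by case/and3P: c1 => s a _; apply: divided_geq le1 s a.
have [le2|lt2] := leqP n (size l2).
  by case/and3P: c2 => s a _; apply: divided_geq le2 s a.
have hye : c + y <= e <= E by move: he hy; clear; lia.
have [/and3P[s a _] sz _] := popped_chain 0 hye hst c3 d3.
apply: divided_geq s a; rewrite sz.
have := leq_b1 pv; have := leq_b1 (isSome pd).
by move: hj hn lt1 lt2; clear; lia.
Qed.

End Scan.

(** Positions b 0 > b 1 > ... are scanned from right to left while the suffixes
    grow. Growth alone does not give disjoint factors, because the places where
    two suffixes differ may lie far to the right. The hypotheses say that the
    difference between consecutive suffixes appears before the next position,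
    and that a prefix repeated at b j.+1 does not turn the text after b j.+1
    into a periodic one; the latter makes every two consecutive repetitions
    yield a new pair of different factors. *)
Lemma descent_divided x E R n (b : nat -> nat) :
  b 0 < E -> 10 * n <= R -> 0 < n ->
  (forall j, j < R -> b j.+1 < b j) ->
  (forall j, j < R -> wgt x (b j.+1) (b j) (b j - b j.+1)) ->
  (forall j e g, j < R -> b j < e <= E -> agree x (b j.+1) (b j) (e - b j) ->
     0 < g <= e - b j -> ~~ agree x (b j.+1) (b j.+1 + g) (e - b j.+1 - g)) ->
  divided x E n.
Proof.
move=> b0 leR n_gt0 b_lt b_gt b_aper.
have hI j : j <= R -> inv x E j (b j).
  elim: j => [_|j IH ltj].
    apply: (@Inv x E 0 (b 0) (b 0).+1 1 [::] [::] [::] [::] None false) => //.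
    - by rewrite ltnSn.
    - by rewrite subSnn.
    - by rewrite subSnn.
  have [d ltd gd] := wgtP _ _ _ _ (b_gt _ ltj).
  apply: (inv_step (b_lt _ ltj) ltd gd) (IH (ltnW ltj)) => e g.
  exact: b_aper.
exact: inv_divided (hI R (leqnn R)) leR n_gt0.
Qed.

(** * Periods, powers and descents *)

Section Periods.
Variable x : nat -> nat.

Lemma period_modn a p L u : 0 < p -> agree x a (a + p) (L - p) -> u < L ->
  x (a + u) = x (a + u %% p).
Proof.
move=> p_gt0 /agreeP A; elim/ltn_ind: u => u IH ltu.
have [ltp|lep] := ltnP u p; first by rewrite modn_small.
have -> : u %% p = (u - p) %% p by rewrite -{1}(subnK lep) modnDr.
rewrite -IH; [|lia|lia].
have := A (u - p); rewrite -addnA subnKC // => <- //; lia.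
Qed.

Lemma period_eq a p L u v : 0 < p -> agree x a (a + p) (L - p) ->
  u < L -> v < L -> u = v %[mod p] -> x (a + u) = x (a + v).
Proof.
move=> p_gt0 A ltu ltv e.
by rewrite (period_modn p_gt0 A ltu) (period_modn p_gt0 A ltv) e.
Qed.

(** Two equal factors of length p in a p-periodic stretch make their distance a
    period as well, since a window of length p determines all letters. *)
Lemma period_shift a p L o o' : 0 < p -> agree x a (a + p) (L - p) ->
  o <= o' -> o' + p <= L -> agree x (a + o) (a + o') p ->
  agree x a (a + (o' - o)) (L - (o' - o)).
Proof.
move=> p_gt0 A leo le_L /agreeP Ao; apply/agreeP => u ltu.
(* the place in the window at o that is congruent to u *)
pose t := (u + (p - o %% p)) %% p.
have ltt : t < p by rewrite ltn_mod.
have et : o + t = u %[mod p].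
  rewrite /t modnDmr -modnDml addnCA subnKC; last by rewrite ltnW ?ltn_mod.
  by rewrite modnDr.
rewrite -addnA (@period_eq a p L u (o + t)) //; [|lia|lia].
rewrite addnA Ao // -addnA; apply: (period_eq p_gt0 A); [lia|lia|].
have -> : o' + t = (o' - o) + (o + t) by lia.
by rewrite -modnDmr et modnDmr.
Qed.

(** No period shorter than n lasts for 2n repetitions from position i on. *)
Definition perfree n i :=
  all (fun q => ~~ agree x i (i + q) ((2 * n - 1) * q)) (iota 1 n.-1).

Lemma perfreeP n i :
  reflect (forall q, 0 < q < n -> ~~ agree x i (i + q) ((2 * n - 1) * q))
          (perfree n i).
Proof.
apply: (iffP allP) => H q; first by move=> hq; apply: H; rewrite mem_iota; lia.
by rewrite mem_iota => hq; apply: H; lia.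
Qed.

(** The period g is at least n. The n rotations of its first n offsets are
    different, as otherwise period_shift would give a period shorter than n. One
    takes them in decreasing order, the j-th from the j-th pair of consecutive
    copies of the period word. *)
Lemma power_divided N n i g : 0 < g -> 0 < n -> i + 2 * n * g <= N ->
  perfree n i -> agree x i (i + g) ((2 * n - 1) * g) -> divided x N n.
Proof.
move=> g_gt0 n_gt0 leN /perfreeP pf A.
have lt_ng : n <= g.
  by rewrite leqNgt; apply/negP => ltg; have := pf g; rewrite g_gt0 ltg A => /(_ isT).
have AL : agree x i (i + g) (2 * n * g - g).
  by move: A; congr agree; nia.
have neq o o' : o < o' < n -> ~~ agree x (i + o) (i + o') g.
  move=> ho; apply/negP => Ao.
  have := pf (o' - o); rewrite (agree_leq _ (period_shift g_gt0 AL _ _ Ao)); [|nia|lia|nia].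
  by move=> /(_ ltac:(lia)).
pose le_off o o' := ~~ wgt x (i + o') (i + o) g.
have tot : total le_off.
  move=> o o'; rewrite /le_off; case: (boolP (wgt x (i + o') (i + o) g)) => //=.
  by move/wgt_asym.
pose s := sort le_off (iota 0 n).
have sz : size s = n by rewrite size_sort size_iota.
have srt : sorted le_off s by apply: sort_sorted.
have us : uniq s by rewrite sort_uniq iota_uniq.
have lt_s j : j < n -> nth 0 s j < n.
  by move=> ltj; have := mem_nth 0 (s := s) (n := j); rewrite sz mem_sort mem_iota => /(_ ltj).
have Aj j o : j < n -> o < n -> agree x (i + (2 * g * j + o)) (i + o) g.
  move=> ltj lto; apply/agreeP => u ltu; rewrite -!addnA.
  apply: (period_eq g_gt0 AL); [nia|nia|].
  by rewrite mulnAC modnMDl.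
apply: (divided_mkseq (f := fun j => (i + (2 * g * j + nth 0 s j), g))) => [j ltj|j ltj] /=.
  have lt1 := lt_s _ (ltnW ltj); have lt2 := lt_s _ ltj.
  apply/andP; split=> /=; first by nia.
  rewrite minnn; apply: agree_wgtl (Aj _ _ (ltnW ltj) lt1) _.
  apply: agree_wgtr (agree_sym (Aj _ _ ltj lt2)) _.
  have /(sortedP 0)/(_ j) := srt; rewrite sz => /(_ ltj) le12.
  have := wgt_total x (i + nth 0 s j) (i + nth 0 s j.+1) g.
  rewrite (negPf le12) orbF; case/orP => // Aoo.
  have := nth_uniq 0 (s := s) (i := j) (j := j.+1); rewrite sz => /(_ (ltnW ltj) ltj us).
  case: (ltngtP (nth 0 s j) (nth 0 s j.+1)) => [lt|lt|->]; last by lia.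
    by have := neq (nth 0 s j) (nth 0 s j.+1); rewrite lt lt2 Aoo => /(_ isT).
  by have := neq (nth 0 s j.+1) (nth 0 s j); rewrite lt lt1 (agree_sym Aoo) => /(_ isT).
by have := lt_s _ ltj; nia.
Qed.

Lemma wgt_nwgt i j k k' : wgt x i j k -> ~~ wgt x j i k'.
Proof.
move=> /(wgt_leq (leq_maxl k k')) /wgt_asym; apply: contra.
exact: wgt_leq (leq_maxr k k').
Qed.

Lemma telescope_leq (z : nat -> nat) m D g :
  (forall i, i < D -> z (m + i) + g <= z (m + i.+1)) -> z m + D * g <= z (m + D).
Proof.
elim: D => [|D IH] H; first by rewrite mul0n !addn0.
have le1 : z m + D * g <= z (m + D) by apply: IH => i lti; apply/H/ltnW.
by have := H D (ltnSn D); rewrite mulSn; lia.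
Qed.

(** A block is a run of D + 1 = 2n positions with decreasing suffixes; z m and
    z (m + D) are the positions which the scan visits. By convexity every common
    prefix of the first and the last suffix is shared by all suffixes of the
    block. *)
Section Blocks.
Variables (N n K D m : nat) (z : nat -> nat).
Hypotheses (n_gt0 : 0 < n) (D_gt0 : 0 < D) (eD : 2 * n = D.+1).
Hypothesis ndiv : ~ divided x N n.
Hypothesis z_lt : forall i, i < D -> z (m + i) < z (m + i.+1).
Hypothesis z_gt : forall i, i < D -> wgt x (z (m + i)) (z (m + i.+1)) K.
Hypothesis z_pf : forall i, i < D -> perfree n (z (m + i)).
Hypothesis z_N : forall i, i <= D -> z (m + i) + K <= N.

Let z_leq i i' : i <= i' <= D -> z (m + i) <= z (m + i').
Proof.
move=> /andP[lei leD]; elim: i' lei leD => [|i' IH]; first by rewrite leqn0 => /eqP->.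
rewrite leq_eqVlt => /orP[/eqP-> //|lti] leD.
by apply: leq_trans (IH lti (ltnW leD)) (ltnW (z_lt leD)).
Qed.

Let z_wgt i i' : i < i' <= D -> wgt x (z (m + i)) (z (m + i')) K.
Proof.
move=> /andP[lei leD]; elim: i' lei leD => // i' IH.
rewrite ltnS leq_eqVlt => /orP[/eqP-> leD|lti leD]; first exact: z_gt.
by apply: wgt_trans (IH lti (ltnW leD)) (z_gt leD).
Qed.

Let z_agree y i : agree x (z m) (z (m + D)) y -> i < D ->
  agree x (z (m + i)) (z (m + i.+1)) y.
Proof.
move=> A lti.
have nw j j' : j <= j' <= D -> ~~ wgt x (z (m + j')) (z (m + j)) y.
  rewrite leq_eqVlt => /andP[/orP[/eqP->|ltj] leD].
    exact: agree_nwgt (agree_refl _ _ _).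
  by apply: wgt_nwgt (z_wgt _); rewrite ltj leD.
have Ai : agree x (z m) (z (m + i)) y.
  have n0 := nw 0 i; rewrite addn0 in n0; have n1 := nw i D.
  by apply: agree_sandwich A; [apply: n0|apply: n1]; move: lti; clear; lia.
have AD : agree x (z (m + i)) (z (m + D)) y by apply: agree_trans (agree_sym Ai) A.
by apply: agree_sandwich AD; apply: nw; move: lti; clear; lia.
Qed.

Let pf i g : i < D -> 0 < g -> z (m + i) + D.+1 * g <= N ->
  ~~ agree x (z (m + i)) (z (m + i) + g) (D * g).
Proof.
move=> lti g_gt0 leN; apply/negP => A; apply: ndiv.
apply: (power_divided g_gt0 n_gt0 _ (z_pf lti)); first by rewrite eD.
by rewrite eD subn1.
Qed.

(** Otherwise the suffixes of the block share a prefix as long as the block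
    itself. One of the D gaps is at most the average, and it is then the period
    of a (D + 1)-st power, which power_divided excludes because D + 1 = 2n. *)
Lemma block_lcp : wgt x (z m) (z (m + D)) (z (m + D) - z m).
Proof.
set s := z (m + D) - z m.
have zD : z m <= z (m + D) by have := @z_leq 0 D; rewrite addn0; apply; lia.
have : wgt x (z m) (z (m + D)) K by have := @z_wgt 0 D; rewrite addn0; apply; lia.
case/wgtP => t lttK gt; have [lts|les] := ltnP t s; first exact: gtat_wgt gt.
have A : agree x (z m) (z (m + D)) s by case/andP: gt => A _; apply: agree_leq A.
have [i lti le_gap] : exists2 i, i < D & D * (z (m + i.+1) - z (m + i)) <= s.
  case: (boolP (has (fun i => D * (z (m + i.+1) - z (m + i)) <= s) (iota 0 D))).
    by case/hasP => i; rewrite mem_iota => lti le_gap; exists i.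
  move/hasPn => H; exfalso.
  have : z m + D * (s %/ D).+1 <= z (m + D).
    apply: telescope_leq => i lti; have := H i; rewrite mem_iota lti => /(_ isT).
    rewrite -ltnNge mulnC -ltn_divLR // => lt_gap.
    by have := z_lt lti; move: lt_gap; lia.
  have := ltn_ceil s D_gt0; rewrite mulnC /s => h1 h2; move: h1 h2 zD; clear; lia.
pose g := z (m + i.+1) - z (m + i).
have lt_z := z_lt lti.
have g_gt0 : 0 < g by rewrite subn_gt0.
have leN : z (m + i) + D.+1 * g <= N.
  have := @z_N i.+1 lti; move: le_gap les lttK lt_z.
  by rewrite /g mulSn; clear; lia.
have := pf lti g_gt0 leN; rewrite /g subnKC; last exact: ltnW.
by rewrite (agree_leq le_gap (z_agree A lti)).
Qed.

(** Let p be the least period. All positions of the block start with the same p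
    letters, so by period_shift each gap is a period, hence at least p. The
    stretch from z m then has at least D + 1 = 2n periods, which power_divided
    excludes. *)
Lemma block_aperiodic e g : z (m + D) < e <= N ->
  agree x (z m) (z (m + D)) (e - z (m + D)) -> 0 < g <= e - z (m + D) ->
  ~~ agree x (z m) (z m + g) (e - z m - g).
Proof.
move=> he A hg; apply/negP => Ag.
pose P p := (0 < p) && agree x (z m) (z m + p) (e - z m - p).
have exP : exists p, P p by exists g; rewrite /P Ag andbT; case/andP: hg.
have [p /andP[p_gt0 Ap] min_p] := ex_minnP exP.
have le_p : p <= e - z (m + D).
  by apply: leq_trans (min_p g _) _; rewrite /P ?Ag; case/andP: hg => // ->.
have zle i : i <= D -> z m <= z (m + i) <= z (m + D).
  by move=> lei; have := @z_leq 0 i; have := @z_leq i D; rewrite addn0; lia.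
have gap i : i < D -> z (m + i) + p <= z (m + i.+1).
  move=> lti; rewrite leqNgt; apply/negP => lt_gap.
  have := zle i (ltnW lti); have := zle i.+1 lti; have := z_lt lti => h1 h2 h3.
  have := min_p (z (m + i.+1) - z (m + i)); rewrite /P subn_gt0 h1 /=.
  have -> : z (m + i.+1) - z (m + i) = (z (m + i.+1) - z m) - (z (m + i) - z m).
    by move: h1 h2 h3; clear; lia.
  rewrite (period_shift p_gt0 Ap); first by move=> /(_ isT); move: lt_gap h1 h2 h3; clear; lia.
  - by move: h1 h2 h3; clear; lia.
  - by move: he le_p h1 h2 h3; clear; lia.
  rewrite !subnKC; [|by case/andP: h2|by case/andP: h3].
  exact: agree_leq le_p (z_agree A lti).
have tele := telescope_leq gap.
have leN : z (m + 0) + D.+1 * p <= N.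
  by move: tele he le_p; rewrite addn0 mulSn; clear; lia.
have := pf D_gt0 p_gt0 leN; rewrite addn0 (agree_leq _ Ap) //.
by move: tele he le_p; clear; lia.
Qed.

End Blocks.

(** Every D-th position of z is visited, from right to left, so that
    descent_divided applies to the 10n blocks. *)
Lemma descending_divided N n K (z : nat -> nat) :
  let M := 10 * n * (2 * n - 1) in 0 < n ->
  (forall m, m < M -> z m < z m.+1) ->
  (forall m, m < M -> wgt x (z m) (z m.+1) K) ->
  (forall m, m <= M -> perfree n (z m)) -> (forall m, m <= M -> z m + K <= N) ->
  ~ divided x N n -> False.
Proof.
move=> M n_gt0 z_lt z_gt z_pf z_N ndiv.
have [D [eD D_gt0 eM]] : exists D, [/\ 2 * n = D.+1, 0 < D & M = 10 * n * D].
  by exists (2 * n - 1); split=> //; move: n_gt0; clear; lia.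
pose b j := z ((10 * n - j) * D).
have bE j : j < 10 * n -> exists m, [/\ m + D <= M, b j.+1 = z m & b j = z (m + D)].
  move=> ltj; exists ((10 * n - j.+1) * D); split=> //.
    by rewrite eM; move: ltj; clear; nia.
  by rewrite /b; congr z; move: ltj; clear; nia.
have M_gt0 : 0 < M by rewrite eM !muln_gt0 n_gt0.
have K_gt0 : 0 < K.
  by have /wgtP[t] := z_gt 0 M_gt0; case: (K).
have blk m : m + D <= M -> forall i, i < D -> m + i < M by clear; lia.
apply: (ndiv); apply: (@descent_divided x N (10 * n) n b) => // [|j ltj|j ltj|j e g ltj].
- by rewrite /b subn0 -eM; have := z_N M (leqnn M); move: K_gt0; clear; lia.
- have [m [leM -> ->]] := bE j ltj.
  have := @telescope_leq z m D 1; rewrite muln1 => H.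
  have : z m + D <= z (m + D).
    by apply: H => i lti; rewrite addn1 addnS; apply: z_lt; exact: blk lti.
  by move: D_gt0; clear; lia.
- have [m [leM -> ->]] := bE j ltj.
  apply: (@block_lcp N n K D m z) => // i lti; rewrite ?addnS.
  + exact: z_lt (blk _ leM _ lti).
  + exact: z_gt (blk _ leM _ lti).
  + exact: z_pf (ltnW (blk _ leM _ lti)).
  + by apply: z_N; move: lti leM; clear; lia.
- have [m [leM -> ->]] := bE j ltj.
  apply: (@block_aperiodic N n K D m z) => // i lti; rewrite ?addnS.
  + exact: z_lt (blk _ leM _ lti).
  + exact: z_gt (blk _ leM _ lti).
  + exact: z_pf (ltnW (blk _ leM _ lti)).
Qed.

End Periods.

(** * Colours and first occurrences *)

Section Colouring.
Variables (x : nat -> nat) (K : nat) (om : pred nat).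

Definition descends i j := (i < j) && wgt x i j K.

(** The length of a longest sequence of positions whose suffixes decrease down to
    the one at i: the greedy partition into chains of Dilworth's theorem. *)
Fixpoint colour_rec f i :=
  if f is f'.+1 then
    \max_(j < i | om j && wgt x j i K) (colour_rec f' j).+1
  else 0.

Definition colour i := colour_rec i i.

Lemma colour_rec_stable f f' i :
  i <= f -> i <= f' -> colour_rec f i = colour_rec f' i.
Proof.
elim: f f' i => [|f IH] [|f'] i //=; rewrite ?leqn0.
- by move=> /eqP-> _; rewrite big_ord0.
- by move=> _ /eqP->; rewrite big_ord0.
- move=> lef lef'; apply: eq_bigr => j _; congr _.+1.
  by apply: IH; rewrite -ltnS; apply: leq_trans (ltn_ord j) _.
Qed.

Lemma colourE i : colour i = \max_(j < i | om j && wgt x j i K) (colour j).+1.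
Proof.
rewrite /colour (@colour_rec_stable i i.+1) //=.
apply: eq_bigr => j _; congr _.+1; apply: colour_rec_stable => //.
exact: ltnW.
Qed.

Lemma colour_mono i j :
  om i -> i < j -> colour i = colour j -> ~~ wgt x i j K.
Proof.
move=> omi ltij e; apply/negP => g.
have := @leq_bigmax_cond _ (fun k : 'I_j => om k && wgt x k j K)
  (fun k => (colour k).+1) (Ordinal ltij).
by rewrite -colourE /= omi g e ltnn => /(_ isT).
Qed.

Lemma descends_trans : transitive descends.
Proof.
move=> j i k /andP[l1 g1] /andP[l2 g2]; apply/andP; split.
  exact: ltn_trans l2.
exact: wgt_trans g2.
Qed.

Lemma colour_chain i : om i -> exists z,
  [/\ size z = colour i, sorted descends (rcons z i) & all om z].
Proof.
elim/ltn_ind: i => i IH omi.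
pose A := [pred j : 'I_i | om j && wgt x j i K].
have [/eqP A0|A_gt0] := posnP #|A|.
  exists [::]; split=> //; rewrite colourE big_pred0 // => j.
  by have := card0_eq (eqP A0) j.
have [j /andP[omj gj] ej] :=
  @eq_bigmax_cond _ A (fun j => (colour j).+1) A_gt0.
have [z [sz srt al]] := IH j (ltn_ord j) omj.
exists (rcons z j); split; last by rewrite all_rcons omj.
  rewrite size_rcons sz [RHS]colourE -ej; apply: eq_bigl => k.
  by rewrite inE.
case: z srt {sz al} => [_|a z srt]; first by rewrite /= /descends ltn_ord gj.
rewrite !rcons_cons /= rcons_path last_rcons.
by move: srt; rewrite rcons_cons /= => ->; rewrite /descends ltn_ord gj.
Qed.

Lemma colour_lt p i : om i ->
  (forall z, sorted descends z -> all om z -> size z <= p) -> colour i < p.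
Proof.
move=> omi H; have [z [sz srt al]] := colour_chain omi.
by have := H _ srt; rewrite all_rcons omi size_rcons sz; apply.
Qed.

End Colouring.

Lemma nth_gap z i j : sorted ltn z -> i <= j < size z ->
  nth 0 z i + (j - i) <= nth 0 z j.
Proof.
move=> srt /andP[leij]; elim: j leij => [|j IH].
  by rewrite leqn0 => /eqP-> _; rewrite subn0 addn0.
rewrite leq_eqVlt => /orP[/eqP-> _|leij ltj]; first by rewrite subnn addn0.
have := IH leij (ltnW ltj); rewrite subSn //.
by have /(sortedP 0)/(_ j ltj) := srt; rewrite /=; lia.
Qed.

(** With prefixes of length n it suffices to take every n-th element of a
    decreasing sequence to make the factors disjoint. *)
Lemma truncated_width x N n z : ~ divided x N n ->
  sorted (descends x n) z -> all (fun i => i + n <= N) z -> size z <= n * n.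
Proof.
move=> ndiv srt al; rewrite leqNgt; apply/negP => lt_nn; apply: ndiv.
have srt_lt : sorted ltn z by apply: sub_sorted srt => i j /andP[].
have nthD := sorted_ltn_nth (@descends_trans x n) 0 srt.
have idx j : j < n -> j * n < size z.
  by move=> ltj; apply: leq_ltn_trans lt_nn; rewrite leq_mul2r ltnW ?orbT.
apply: (divided_mkseq (f := fun j => (nth 0 z (j * n), n))) => j ltj /=; last first.
  by move/allP: al; apply; apply: mem_nth; apply: idx.
have h1 := idx _ (ltnW ltj); have h2 := idx _ ltj.
apply/andP; split=> /=; last first.
  have lt_j : j * n < j.+1 * n by rewrite ltn_mul2r ltnSn andbT; case: (n) ltj.
  by rewrite minnn; have /andP[] := nthD _ _ h1 h2 lt_j.
have := @nth_gap z (j * n) (j.+1 * n) srt_lt.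
by rewrite h2 leq_mul2r leqnSn orbT mulSn addnK => /(_ isT).
Qed.

(** With prefixes of arbitrary length K there is still a bound in terms of n
    alone, provided that no position starts a long power. *)
Lemma perfree_width x N n K z : ~ divided x N n -> 0 < n ->
  sorted (descends x K) z -> all (fun i => perfree x n i && (i + K <= N)) z ->
  size z <= 10 * n * (2 * n - 1).
Proof.
move=> ndiv n_gt0 srt /allP al; rewrite leqNgt; apply/negP => lt_s.
apply: (@descending_divided x N n K (nth 0 z) n_gt0) => // m lem.
- by have /(sortedP 0)/(_ m)/(_ (leq_ltn_trans lem lt_s))/andP[] := srt.
- by have /(sortedP 0)/(_ m)/(_ (leq_ltn_trans lem lt_s))/andP[] := srt.
- by have /al/andP[] := mem_nth 0 (leq_ltn_trans lem lt_s).
- by have /al/andP[] := mem_nth 0 (leq_ltn_trans lem lt_s).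
Qed.

Lemma leq_size_codes (T1 T2 : eqType) (s : seq T1) (t : seq T2) f :
  uniq s -> {in s &, injective f} -> (forall a, a \in s -> f a \in t) ->
  size s <= size t.
Proof.
move=> us inj_f sub; rewrite -(size_map f); apply: uniq_leq_size.
  by rewrite map_inj_in_uniq.
by move=> _ /mapP[a /sub fa ->].
Qed.

Definition near L (t : seq nat) i := has (fun e => (i <= e) && (e < i + L)) t.

(** Each element of t is near at most L positions. *)
Lemma count_near L t s : uniq s -> count (near L t) s <= L * size t.
Proof.
move=> us; rewrite -size_filter mulnC -[X in _ * X](size_iota 0 L).
rewrite -(size_allpairs (fun e u => e.+1 - L + u)); apply: uniq_leq_size.
  exact: filter_uniq.
move=> i; rewrite mem_filter => /andP[/hasP[e te /andP[le1 le2]] _].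
have -> : i = e.+1 - L + (i - (e.+1 - L)) by lia.
by apply: (allpairs_f _ te); rewrite mem_iota; lia.
Qed.

(** Along a colour suffixes do not decrease. So the prefixes of length k at the
    positions of one colour never return to an earlier value, and change only
    at first occurrences, the breaks. *)
Section Breaks.
Variables (x : nat -> nat) (M p K : nat) (om : pred nat) (chi : nat -> nat).
Hypothesis om_lt : forall i, om i -> i < M.
Hypothesis chi_lt : forall i, om i -> chi i < p.
Hypothesis chi_mono : forall i j,
  om i -> i < j -> chi i = chi j -> ~~ wgt x i j K.

Definition is_break k i := om i &&
  all (fun j => ~~ [&& om j, chi j == chi i & agree x j i k]) (iota 0 i).

Definition breaks k := filter (is_break k) (iota 0 M).

Definition ends := filter (fun i => om i && ~~ om i.+1) (iota 0 M).

Lemma mem_breaks k i : (i \in breaks k) = is_break k i.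
Proof.
rewrite mem_filter mem_iota andb_idr // => /andP[/om_lt].
by rewrite add0n.
Qed.

Lemma first_occurrence k i : om i ->
  exists j, [/\ j <= i, is_break k j, chi j = chi i & agree x j i k].
Proof.
move=> omi; pose P j := [&& om j, chi j == chi i & agree x j i k].
have exP : exists j, P j by exists i; rewrite /P omi eqxx agree_refl.
have [j /and3P[omj /eqP ej Aj] min_j] := ex_minnP exP.
exists j; split=> //; first by apply: min_j; rewrite /P omi eqxx agree_refl.
apply/andP; split=> //; apply/allP => j'; rewrite mem_iota add0n => lt_j.
apply/negP => /and3P[omj' /eqP ej' Aj'].
have := min_j j'; rewrite /P omj' ej' ej eqxx (agree_trans Aj' Aj) /=.
by move=> /(_ isT); rewrite leqNgt; case/andP: lt_j => _ ->.
Qed.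

(** The prefix at y' occurred first at some j before y, and the suffix at y lies
    between those at j and y'. *)
Lemma stable_prefix k s y y' : k <= K -> om y -> om y' -> chi y = chi y' ->
  s <= y < y' -> (forall j, s < j <= y' -> ~~ is_break k j) ->
  agree x y y' k.
Proof.
move=> lek omy omy' e /andP[lesy lty] nb.
have [j [lej bj ej Aj]] := first_occurrence k omy'.
have les : j <= s.
  by rewrite leqNgt; apply/negP => lts; have := nb j; rewrite lts lej bj => /(_ isT).
have [ej'|ltj] := leqP y j; first by have -> : y = j by lia.
have omj : om j by case/andP: bj.
have ejy : chi j = chi y by rewrite ej e.
have nw1 : ~~ wgt x j y k.
  by apply: contra (chi_mono omj ltj ejy); apply: wgt_leq.
have nw2 : ~~ wgt x y y' k.
  by apply: contra (chi_mono omy lty e); apply: wgt_leq.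
exact: agree_sym (agree_sandwich nw2 nw1 (agree_sym Aj)).
Qed.

Definition breaks_before k i := count (fun b => b <= i) (breaks k).

Lemma same_breaks_before k i i' j : i <= i' ->
  breaks_before k i = breaks_before k i' -> i < j <= i' -> ~~ is_break k j.
Proof.
move=> lei e /andP[lt_ij le_ji]; apply/negP => bj.
have : breaks_before k i < breaks_before k i'; last by rewrite e ltnn.
rewrite /breaks_before -!size_filter.
have := @uniq_leq_size _ (j :: filter (fun b => b <= i) (breaks k))
  (filter (fun b => b <= i') (breaks k)).
apply.
  rewrite /= mem_filter leqNgt lt_ij /= !filter_uniq // iota_uniq //.
move=> b; rewrite inE => /orP[/eqP->|]; first by rewrite mem_filter le_ji mem_breaks.
rewrite !(mem_filter (fun b => b <= _)) => /andP[leb ->].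
by rewrite (leq_trans leb).
Qed.

(** Away from the ends of the domain and from first occurrences of k-prefixes,
    the prefix of length 3k at i consists of the k-prefixes at i, i + k and
    i + 2k, and these are determined by three colours and by the number of
    first occurrences up to i. *)
Lemma tripling k k' : k <= K -> k' <= 3 * k ->
  size (breaks k') + size ends + 1
    <= (size (breaks k) + size ends + 1) * (p ^ 3 + 2 * k + 1).
Proof.
move=> lek lek'.
pose c1 := near (2 * k) ends; pose c2 := near (2 * k + 1) (breaks k).
have ub : uniq (breaks k') by rewrite filter_uniq ?iota_uniq.
pose s := filter (predC (predU c1 c2)) (breaks k').
have le_s : size (breaks k') <= count c1 (breaks k') + count c2 (breaks k') + size s.
  rewrite -(count_predC (predU c1 c2)) size_filter leq_add2r.
  by rewrite -count_predUI leq_addr.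
have le1 := count_near (2 * k) ends ub.
have le2 := count_near (2 * k + 1) (breaks k) ub.
suff le3 : size s <= (size (breaks k)).+1 * p ^ 3.
  move: le_s le1 le2 le3; rewrite -/c1 -/c2.
  by move: (count c1 _) (count c2 _) (size s) (p ^ 3); clear; nia.
have hs i : i \in s -> forall j, i <= j <= i + 2 * k -> om j.
  rewrite mem_filter /= negb_or => /andP[/andP[nc1 _]].
  rewrite mem_breaks => /andP[omi _]; elim=> [|j IH] lej.
    by have -> : 0 = i by lia.
  have [eij|nij] := eqVneq i j.+1; first by rewrite -eij.
  apply/negPn/negP => nomj; have omj : om j by apply: IH; lia.
  move/hasPn: nc1 => /(_ j); rewrite mem_filter omj nomj mem_iota om_lt //=.
  by move=> /(_ isT); lia.
have nbs i : i \in s -> forall j, i <= j <= i + 2 * k -> ~~ is_break k j.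
  rewrite mem_filter /= negb_or => /andP[/andP[_ nc2] _] j lej.
  apply/negP => bj; move/hasPn: nc2 => /(_ j).
  by rewrite mem_breaks => /(_ bj); lia.
pose t := allpairs pair (iota 0 (size (breaks k)).+1)
  (allpairs pair (iota 0 p) (allpairs pair (iota 0 p) (iota 0 p))).
have -> : (size (breaks k)).+1 * p ^ 3 = size t.
  by rewrite !size_allpairs !size_iota.
pose f i := (breaks_before k i, (chi i, (chi (i + k), chi (i + 2 * k)))).
apply: (leq_size_codes (f := f)); first exact: filter_uniq.
  move=> i i' si si' [].
  wlog lti : i i' si si' / i < i'.
    move=> H e1 e2 e3 e4; case: (ltngtP i i') => // lt; first exact: H.
    by apply/esym; apply: H.
  move=> e1 e2 e3 e4; exfalso.
  have nb j : i <= j <= i' + 2 * k -> ~~ is_break k j.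
    case: (leqP j (i + 2 * k)) => [lej h|ltj h]; first by apply: (nbs i si); lia.
    case: (leqP j i') => [lej'|ltj']; last by apply: (nbs i' si'); lia.
    by apply: (same_breaks_before (ltnW lti) e1); lia.
  have A u : u <= 2 * k -> chi (i + u) = chi (i' + u) -> agree x (i + u) (i' + u) k.
    move=> leu e; apply: (stable_prefix lek _ _ e (s := i + u)).
    - by apply: (hs i si); lia.
    - by apply: (hs i' si'); lia.
    - by lia.
    - by move=> j h; apply: nb; lia.
  have A0 := A 0 (leq0n _); rewrite !addn0 in A0.
  have A1 : agree x i i' (k + (k + k)).
    apply: (agree_cat (A0 e2)); apply: agree_cat; first by apply: A => //; lia.
    by rewrite -!addnA addnn -mul2n; apply: A.
  have := si'; rewrite mem_filter => /andP[_]; rewrite mem_breaks => /andP[_].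
  move=> /allP/(_ i); rewrite mem_iota lti => /(_ isT).
  have omi : om i by apply: (hs i si); lia.
  by rewrite omi e2 eqxx (agree_leq _ A1) //; lia.
move=> i si; have ok j : i <= j <= i + 2 * k -> chi j \in iota 0 p.
  by move=> h; rewrite mem_iota add0n chi_lt // (hs i si).
apply: allpairs_f; first by rewrite mem_iota ltnS count_size.
apply: allpairs_f; first by apply: ok; lia.
by apply: allpairs_f; apply: ok; lia.
Qed.

(** About log_3 (K / k) triplings lead from length k to length K; they are the
    source of the logarithm in the exponent of the bound. *)
Lemma iterated_tripling k a : k <= K ->
  size (breaks (minn (3 ^ a * k) K)) + size ends + 1
    <= (size (breaks k) + size ends + 1) * (p ^ 3 + 2 * K + 1) ^ a.
Proof.
move=> lek; elim: a => [|a IH]; first by rewrite mul1n (minn_idPl lek) muln1.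
have le1 : minn (3 ^ a * k) K <= K by exact: geq_minr.
have le2 : minn (3 ^ a.+1 * k) K <= 3 * minn (3 ^ a * k) K.
  by rewrite expnS -mulnA minnMr leq_min geq_minl (leq_trans (geq_minr _ _)) ?leq_pmull.
apply: leq_trans (tripling le1 le2) _; rewrite [_ ^ a.+1]expnSr mulnA; apply: leq_mul => //.
by rewrite !leq_add2r leq_add2l leq_mul2l.
Qed.

Lemma breaks_leq_factors k (W : seq (seq nat)) :
  (forall i, om i -> factor x i k \in W) -> size (breaks k) <= p * size W.
Proof.
move=> sub; rewrite -[X in X * _](size_iota 0 p) -(size_allpairs pair).
apply: (leq_size_codes (f := fun i => (chi i, factor x i k))).
- by rewrite filter_uniq ?iota_uniq.
- move=> i i'; rewrite !mem_breaks => bi bi' [].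
  wlog lti : i i' bi bi' / i < i'.
    move=> H e1 e2; case: (ltngtP i i') => // lt; first exact: H.
    by apply/esym; apply: H.
  move=> e1 /eqP; rewrite factor_agree => A; case/andP: bi' => _ /allP/(_ i).
  rewrite mem_iota lti /= e1 eqxx A.
  by case/andP: bi => -> _ /(_ isT).
- move=> i; rewrite mem_breaks => /andP[omi _]; apply: allpairs_f (sub _ omi).
  by rewrite mem_iota add0n chi_lt.
Qed.

Lemma factors_leq_breaks k :
  size (undup [seq factor x i k | i <- iota 0 M & om i]) <= size (breaks k).
Proof.
rewrite -(size_map (fun i => factor x i k)); apply: uniq_leq_size.
  exact: undup_uniq.
move=> w; rewrite mem_undup => /mapP[i]; rewrite mem_filter => /andP[omi _] ->.
have [j [_ bj _ A]] := first_occurrence k omi.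
apply/mapP; exists j; first by rewrite mem_breaks.
by apply/eqP; rewrite eq_sym factor_agree.
Qed.

Lemma breaks_mono k : {subset breaks k <= breaks k.+1}.
Proof.
move=> i; rewrite !mem_breaks => /andP[omi /allP H]; rewrite /is_break omi.
apply/allP => j /H; apply: contra => /and3P[-> -> A].
exact: agree_leq A.
Qed.

(** If lengths k and k + 1 have equally many first occurrences, then the prefix
    of length k determines the next letter. *)
Lemma stable_breaks_agree k y y' : om y -> om y' -> chi y = chi y' ->
  size (breaks k.+1) <= size (breaks k) -> agree x y y' k -> agree x y y' k.+1.
Proof.
move=> omy omy' e le_s A.
have ub : uniq (breaks k) by rewrite filter_uniq ?iota_uniq.
have [_ eb] := uniq_min_size ub (@breaks_mono k) le_s.
have [j [_ bj ej Aj]] := first_occurrence k.+1 omy.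
have [j' [_ bj' ej' Aj']] := first_occurrence k.+1 omy'.
suff ejj : j = j' by apply: agree_trans (agree_sym Aj) _; rewrite ejj.
have kb i : is_break k.+1 i -> is_break k i by rewrite -!mem_breaks eb.
have Ajj : agree x j j' k.
  apply: agree_trans (agree_leq (leqnSn _) Aj) _; apply: agree_trans A _.
  exact: agree_sym (agree_leq (leqnSn _) Aj').
have no i i' : is_break k i -> is_break k i' -> chi i = chi i' ->
    agree x i i' k -> ~~ (i < i').
  move=> /andP[omi _] /andP[_ /allP/(_ i)]; rewrite mem_iota => H ei Ai.
  by apply/negP => lti; have := H lti; rewrite omi ei eqxx Ai.
have n1 := no j j' (kb _ bj) (kb _ bj').
have n2 := no j' j (kb _ bj') (kb _ bj).
case: (ltngtP j j') => // lt.
  by have := n1; rewrite lt ej e ej' Ajj => /(_ erefl isT).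
by have := n2; rewrite lt ej e ej' (agree_sym Ajj) => /(_ erefl isT).
Qed.

End Breaks.

(** * Power-free stretches *)

Section PowerFree.
Variables (x : nat -> nat) (M p K N n : nat) (om : pred nat) (chi : nat -> nat).
Hypothesis om_lt : forall i, om i -> i < M.
Hypothesis chi_lt : forall i, om i -> chi i < p.
Hypothesis chi_mono : forall i j,
  om i -> i < j -> chi i = chi j -> ~~ wgt x i j K.
Hypotheses (n_gt0 : 0 < n) (p_gt0 : 0 < p) (lt_pK : p < K).
Hypothesis om_N : forall i, om i -> i + K <= N.
Hypothesis om_pf : forall i g, om i -> 0 < g -> i + 2 * n * g <= N ->
  ~~ agree x i (i + g) ((2 * n - 1) * g).

Let L := (2 * n + 1) * p.

(** The argument of Morse and Hedlund: without new first occurrences the prefix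
    of length K depends only on the colour, so at most p < K prefixes occur,
    and for some k < K the prefix of length k determines the next letter. Among
    p + 1 consecutive positions two have the same colour; their distance is
    then a period of the rest of the stretch, which is long enough for a 2n-th
    power. *)
Lemma short_stable_run i : (forall j, i <= j < i + L -> om j) ->
  (forall j, i < j < i + L -> ~~ is_break x om chi K j) -> False.
Proof.
move=> omI nb.
have hL : i + p < i + L by rewrite /L; move: p_gt0 n_gt0; clear; nia.
have A y y' : i <= y < i + L -> i <= y' < i + L -> chi y = chi y' ->
    agree x y y' K.
  wlog lty : y y' / y < y'.
    move=> H hy hy' e; case: (ltngtP y y') => [lt|lt|->].
    - exact: H.
    - by apply: agree_sym; apply: H.
    - exact: agree_refl.
  move=> hy hy' e; apply: (stable_prefix chi_mono (leqnn K) _ _ e (s := i)).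
  - exact: omI.
  - exact: omI.
  - by rewrite lty andbT; case/andP: hy.
  - by move=> j hj; apply: nb; move: hj hy'; clear; lia.
(* one colour only: the breaks in I then count its different k-prefixes *)
pose I y := i <= y < i + L; pose B k := breaks x (i + L) I (fun=> 0) k.
have I_lt y : I y -> y < i + L by case/andP.
have leB k : k <= K -> size (B k) <= p.
  move=> lek; rewrite -(size_iota 0 p); apply: (leq_size_codes (f := chi)).
  - by rewrite filter_uniq ?iota_uniq.
  - move=> y y'; rewrite !(mem_breaks x _ I_lt).
    wlog lty : y y' / y < y'.
      move=> H b b' e; case: (ltngtP y y') => // lt; first exact: H.
      by apply/esym; apply: H.
    move=> /andP[Iy _] /andP[Iy' /allP/(_ y)] H e; exfalso; move: H.
    by rewrite mem_iota lty Iy (agree_leq lek (A _ _ Iy Iy' e)) => /(_ isT).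
  - by move=> y; rewrite (mem_breaks x _ I_lt) => /andP[Iy _]; rewrite mem_iota chi_lt ?omI.
have [k lek le_k] : exists2 k, k < K & size (B k.+1) <= size (B k).
  case: (boolP (has (fun k => size (B k.+1) <= size (B k)) (iota 0 K))).
    by case/hasP => k; rewrite mem_iota => ltk; exists k.
  move/hasPn => H; exfalso.
  have : forall k, k <= K -> k <= size (B k).
    elim=> // k IH ltk; have := H k; rewrite mem_iota ltk -ltnNge => /(_ isT).
    by apply: leq_ltn_trans; apply/IH/ltnW.
  by move=> /(_ K (leqnn K)); have := leB K (leqnn K); move: lt_pK; clear; lia.
have det y y' : I y -> I y' -> agree x y y' k -> agree x y y' k.+1.
  move=> Iy Iy' Ak.
  exact: (stable_breaks_agree I_lt Iy Iy' (erefl 0) le_k Ak).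
have : ~~ uniq [seq chi y | y <- iota i p.+1].
  apply/negP => u; have := uniq_leq_size u (s2 := iota 0 p).
  rewrite size_map !size_iota ltnn => H; suff : false by []; apply: H => c.
  case/mapP => y; rewrite mem_iota => hy ->; rewrite mem_iota chi_lt //.
  by apply: omI; move: hy hL; clear; lia.
case/(uniqPn 0) => u [u' []]; rewrite size_map size_iota => ltu ltu'.
have ltu2 : u < p.+1 by apply: ltn_trans ltu'.
rewrite !(nth_map 0) ?size_iota // !nth_iota // => e.
pose y := i + u; pose g := u' - u.
have ey' : i + u' = y + g by rewrite /y /g; move: ltu; clear; lia.
have hg : 0 < g <= p by rewrite /g; move: ltu ltu'; clear; lia.
have hy : y < i + p by rewrite /y; move: ltu ltu'; clear; lia.
have iy : i <= y by exact: leq_addr.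
rewrite ey' in e.
have leL : y + 2 * n * g < i + L.
  have : 2 * n * g <= 2 * n * p.
    by rewrite leq_mul2l; apply/orP; right; case/andP: hg.
  by move: hy; rewrite /L mulnDl mul1n; clear; lia.
have leg : y + g < i + L.
  by move: hg hy hL; rewrite /L; clear -n_gt0; nia.
have An t : y + g + t < i + L -> agree x (y + t) (y + g + t) k.
  elim: t => [|t IH] ltt.
    rewrite !addn0; apply: agree_leq (A _ _ _ _ e); first exact: ltnW.
      by move: iy leg hg; clear; lia.
    by move: iy leg hg; clear; lia.
  have It : I (y + t) by rewrite /I; move: iy ltt; clear; lia.
  have Igt : I (y + g + t) by rewrite /I; move: iy ltt; clear; lia.
  have lt_t : y + g + t < i + L by move: ltt; clear; lia.
  have := agree_shift (s := 1) (ltn0Sn k) (det _ _ It Igt (IH lt_t)).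
  by rewrite -!addnA !addn1 subn1.
have omy : om y by apply: omI; rewrite iy; move: hy hL; clear; lia.
have g_gt0 : 0 < g by case/andP: hg.
have : y + 2 * n * g <= N.
  have oml : om (i + L).-1 by apply: omI; move: leL iy; clear; lia.
  by have := om_N oml; move: leL lt_pK; clear; lia.
move=> /(om_pf omy g_gt0)/negP; apply; apply/agreeP => v ltv.
have ltv' : y + g + v < i + L.
  move: ltv leL; rewrite mulnBl mul1n; clear; lia.
have It : I (y + v) by rewrite /I; move: iy ltv'; clear; lia.
have Igt : I (y + g + v) by rewrite /I; move: iy ltv'; clear; lia.
have := det _ _ It Igt (An v ltv') => /agreeP/(_ 0 isT).
by rewrite !addn0.
Qed.

(** Within L steps of a position there is an end of the domain or a first
    occurrence. *)
Lemma size_om_leq :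
  size (filter om (iota 0 M)) <= L * (size (ends M om) + size (breaks x M om chi K)).
Proof.
pose c1 := near L (ends M om); pose c2 := near L (breaks x M om chi K).
have ub : uniq (filter om (iota 0 M)) by rewrite filter_uniq ?iota_uniq.
have L_gt0 : 0 < L by rewrite muln_gt0 p_gt0 addn1.
have cover i : i \in filter om (iota 0 M) -> predU c1 c2 i.
  rewrite mem_filter => /andP[omi _] /=; apply/negPn/negP.
  rewrite negb_or => /andP[nc1 nc2].
  have omI j : i <= j < i + L -> om j.
    elim: j => [|j IH] hj; first by have -> : 0 = i by move: hj; clear; lia.
    have [eij|nij] := eqVneq i j.+1; first by rewrite -eij.
    have hj' : i <= j < i + L by move: hj nij; clear; lia.
    apply/negPn/negP => nomj; move/hasPn: nc1 => /(_ j).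
    by rewrite mem_filter (IH hj') nomj mem_iota om_lt ?IH // hj' => /(_ isT).
  apply: (@short_stable_run i omI) => j hj; apply/negP => bj.
  move/hasPn: nc2 => /(_ j); rewrite mem_breaks // => /(_ bj).
  by case/andP: hj => /ltnW -> ->.
have := count_predUI c1 c2 (filter om (iota 0 M)).
have -> : count (predU c1 c2) (filter om (iota 0 M)) = size (filter om (iota 0 M)).
  by apply/eqP; rewrite -all_count; apply/allP.
have := count_near L (ends M om) ub; have := count_near L (breaks x M om chi K) ub.
rewrite -/c1 -/c2 mulnDr; clear; lia.
Qed.

End PowerFree.

(** * Maximal periodic stretches and tilings *)

Lemma fibre_leq (T : eqType) (s : seq nat) (t : seq T) f m :
  (forall a, a \in s -> f a \in t) ->
  (forall w, count (fun a => f a == w) s <= m) -> size s <= m * size t.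
Proof.
elim: t s => [|w t IH] s sub fib.
  by case: s sub {fib} => // a s /(_ a (mem_head _ _)).
rewrite -(count_predC (fun a => f a == w)) mulnS; apply: leq_add => //.
rewrite -size_filter; apply: IH => [a|v].
  rewrite mem_filter => /andP[/= ne /sub]; rewrite inE.
  by rewrite (negPf ne).
apply: leq_trans (fib v); rewrite count_filter; apply: sub_count => a.
by case/andP.
Qed.

Lemma leq_size_rel (T : eqType) (s : seq nat) (t : seq T) (r : nat -> T -> bool) :
  uniq s -> (forall a, a \in s -> has (r a) t) ->
  (forall a a' c, a \in s -> a' \in s -> r a c -> r a' c -> a = a') ->
  size s <= size t.
Proof.
case: t => [|c0 t] us ex inj.
  by case: s ex {us inj} => // a s /(_ a (mem_head _ _)).
apply: (leq_size_codes (f := fun a => nth c0 (c0 :: t) (find (r a) (c0 :: t)))) => //.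
  move=> a a' sa sa' e; apply: (inj a a' _ sa sa' (nth_find c0 (ex _ sa))).
  by rewrite e; apply: nth_find (ex _ sa').
by move=> a sa; rewrite mem_nth // -has_find; apply: ex.
Qed.

Section Runs.
Variables (x : nat -> nat) (N n : nat).
Hypotheses (n_gt1 : 1 < n) (ndiv : ~ divided x N n).

Let n_gt0 : 0 < n. Proof. exact: ltnW. Qed.

Definition run i q := agree x i (i + q) ((2 * n - 1) * q).

(** X is the first position at which a stretch of period q, at least 2n periods
    long, breaks off. *)
Definition event q X :=
  [&& 2 * n * q <= X, X < N, run (X - 2 * n * q) q & x X != x (X - q)].

Definition events q := filter (event q) (iota 0 N).

Definition factors := undup [seq factor x i n | i <- iota 0 N.+1 & i + n <= N].

(** The last 2n periods before X' satisfy the periodicity that fails at X. *)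
Lemma event_gap q X X' : event q X -> event q X' -> X < X' ->
  X + (2 * n - 1) * q < X'.
Proof.
move=> /and4P[le1 _ _ neq] /and4P[le2 _ /agreeP A _] ltX.
rewrite ltnNge; apply/negP => leX; case/negP: neq; apply/eqP.
have [e1 e2 e3] : [/\ 2 * n * q = q + (2 * n - 1) * q, q <= X - (X' - 2 * n * q)
    & X - q - (X' - 2 * n * q) < (2 * n - 1) * q].
  have e1 : 2 * n * q = q + (2 * n - 1) * q.
    by move: n_gt0; clear; nia.
  by move: le1 le2 leX ltX; rewrite e1; move: (_ * q) => m; clear; split; lia.
have := A _ e3; set a := X' - 2 * n * q.
have le_a : a + q <= X by move: e2 le2; rewrite -/a; move: ltX leX e1; rewrite /a; move: (_ * q) => m; clear; lia.
have -> : a + (X - q - a) = X - q by move: le_a; clear; lia.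
by have -> : a + q + (X - q - a) = X by move: le_a; clear; lia.
Qed.
Lemma event_back q X m v : 0 < q -> event q X -> m <= n -> v < m * q ->
  x (X - m * q + v) = x (X - q + v %% q).
Proof.
move=> q_gt0 /and4P[leX _ A _] lem ltv; rewrite /run mulnBl mul1n in A.
have mq : m * q <= n * q by rewrite leq_mul2r lem orbT.
have e2 : 2 * n * q = n * q + n * q by rewrite -mulnA mul2n addnn.
have hq : q <= n * q by rewrite leq_pmull.
have ltvq : v %% q < q by rewrite ltn_mod.
have m_gt0 : 0 < m by case: (m) ltv.
have hqm : q <= m * q by rewrite leq_pmull.
set a := X - _ in A.
have -> : X - m * q + v = a + (2 * n * q - m * q + v).
  by rewrite /a; move: leX mq e2 ltv; clear; lia.
have -> : X - q + v %% q = a + (2 * n * q - q + v %% q).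
  by rewrite /a; move: leX hq e2; clear; lia.
apply: (period_eq q_gt0 A); [by move: mq e2 ltv; clear; lia| |].
  by move: hq e2 ltvq; clear; lia.
have e1 : 2 * n * q - m * q + v = (2 * n - m) * q + v by rewrite mulnBl.
have e3 : 2 * n * q - q + v %% q = (2 * n - 1) * q + v %% q.
  by rewrite mulnBl mul1n.
by rewrite e1 e3 !modnMDl modn_mod.
Qed.

(** Suppose that n stretches of period q end with the same n letters, and that
    the letters which break the period deviate in the same direction. Let v
    be the common word of the last q letters. If the deviation is downwards,
    the j-th factor is the last n - 1 - j copies of v in its stretch and one
    more letter: where the next factor has its deviating letter, this one
    still has the larger letter that begins v. If it is upwards, one takes the
    last j copies instead. *)
Lemma event_fibre q w b : 0 < q < n ->
  count (fun X => (factor x (X - n) n, x X < x (X - q)) == (w, b)) (events q)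
    <= n.-1.
Proof.
move=> /andP[q_gt0 lt_qn]; rewrite -size_filter; set z := filter _ _.
rewrite -ltnS prednK // ltnNge; apply/negP => le_n; apply: ndiv.
have srt : sorted ltn z.
  by do 2!apply: (sorted_filter ltn_trans); apply: iota_ltn_sorted.
have zP j : j < n -> [/\ event q (nth 0 z j), factor x (nth 0 z j - n) n = w
    & (x (nth 0 z j) < x (nth 0 z j - q)) = b].
  move=> ltj; have := mem_nth 0 (leq_trans ltj le_n).
  by rewrite mem_filter /= mem_filter => /and3P[/eqP[-> ->] -> _].
have z_lt j : j.+1 < n -> nth 0 z j < nth 0 z j.+1.
  by move=> ltj; have /(sortedP 0)/(_ j (leq_trans ltj le_n)) := srt.
have n_leX j : j < n -> n <= nth 0 z j.
  case/zP => /and4P[leX _ _ _] _ _; apply: leq_trans leX.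
  by rewrite -mulnA mulnCA leq_pmulr // muln_gt0.
have Aq j j' : j < n -> j' < n -> agree x (nth 0 z j - q) (nth 0 z j' - q) q.
  move=> ltj ltj'; have [_ f1 _] := zP _ ltj; have [_ f2 _] := zP _ ltj'.
  have A : agree x (nth 0 z j - n) (nth 0 z j' - n) n.
    by rewrite -factor_agree f1 f2.
  have := agree_shift (leq_subr q n) A.
  have := n_leX _ ltj; have := n_leX _ ltj'.
  have -> : n - (n - q) = q by move: lt_qn; clear; lia.
  have e X : n <= X -> X - n + (n - q) = X - q by move: lt_qn; clear; lia.
  by move=> /e-> /e->.
have period j j' m : j < n -> j' < n -> m <= n ->
    agree x (nth 0 z j - m * q) (nth 0 z j' - m * q) (m * q).
  move=> ltj ltj' lem; apply/agreeP => v ltv.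
  have [ev1 _ _] := zP _ ltj; have [ev2 _ _] := zP _ ltj'.
  rewrite (event_back q_gt0 ev1 lem ltv) (event_back q_gt0 ev2 lem ltv).
  by have /agreeP := Aq _ _ ltj ltj'; apply; rewrite ltn_mod.
have gap j m : j.+1 < n -> m < n -> nth 0 z j + m * q < nth 0 z j.+1.
  move=> ltj ltm; have [ev1 _ _] := zP _ (ltnW ltj); have [ev2 _ _] := zP _ ltj.
  apply: leq_ltn_trans (event_gap ev1 ev2 (z_lt _ ltj)).
  by rewrite leq_add2l leq_mul2r; move: ltm; clear; lia.
have zN j : j < n -> nth 0 z j < N by case/zP => /and4P[].
have lastq j : j < n -> x (nth 0 z j - q) = x (nth 0 z 0 - q).
  by move=> ltj; have /agreeP/(_ 0 q_gt0) := Aq _ _ ltj n_gt0; rewrite !addn0.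
have mqX j m : j < n -> m <= n -> m * q <= nth 0 z j.
  case/zP => /and4P[leX _ _ _] _ _ lem; apply: leq_trans leX.
  by rewrite leq_mul2r; move: lem; clear; lia.
clearbody z; case: b zP => zP.
- apply: (divided_mkseq (f := fun j =>
    (nth 0 z j - (n.-1 - j) * q, ((n.-1 - j) * q).+1))) => j ltj /=; last first.
    rewrite addnS subnK ?zN // mqX //; clear; lia.
  have [m em em'] : exists2 m, n.-1 - j = m.+1 & n.-1 - j.+1 = m.
    by exists (n.-1 - j.+1) => //; move: ltj; clear; lia.
  have ltm : m.+1 < n by move: em; clear -n_gt0; lia.
  rewrite em em'; have ltj0 := ltnW ltj; apply/andP; split=> /=.
    rewrite addnS subnK; last by apply: mqX => //; exact: ltnW.
    by rewrite ltn_subRL addnC gap // ltnW.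
  apply: (@gtat_wgt _ (m * q)); first by rewrite leq_min ltnSn ltnS leq_mul2r leqnSn orbT.
  have [_ _ lt2] := zP _ ltj.
  apply/andP; split.
    apply/agreeP => v ltv.
    have ltv' : v < m.+1 * q by apply: leq_trans ltv _; rewrite leq_mul2r leqnSn orbT.
    have [ev1 _ _] := zP _ ltj0; have [ev2 _ _] := zP _ ltj.
    rewrite (event_back q_gt0 ev1 (ltnW ltm) ltv').
    rewrite (event_back q_gt0 ev2 (ltnW (ltnW ltm)) ltv).
    by have /agreeP := Aq _ _ ltj0 ltj; apply; rewrite ltn_mod.
  rewrite subnK; last by apply: mqX => //; do 2!apply: ltnW.
  have -> : nth 0 z j - m.+1 * q + m * q = nth 0 z j - q.
    have := mqX j m.+1 ltj0 (ltnW ltm).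
    by rewrite mulSn; move: (m * q) => k; clear; lia.
  by rewrite (lastq _ ltj0) -(lastq _ ltj) lt2.
- apply: (divided_mkseq (f := fun j =>
    (nth 0 z j - j * q, (j * q).+1))) => j ltj /=; last first.
    by rewrite addnS subnK ?zN // mqX // ltnW.
  have ltj0 := ltnW ltj; apply/andP; split=> /=.
    rewrite addnS subnK; last by apply: mqX => //; exact: ltnW.
    by rewrite ltn_subRL addnC gap.
  apply: (@gtat_wgt _ (j * q)).
    by rewrite leq_min ltnSn ltnS leq_mul2r leqnSn orbT.
  have [/and4P[_ _ _ neq] _ nlt] := zP _ ltj0.
  apply/andP; split.
    apply/agreeP => v ltv.
    have ltv' : v < j.+1 * q by apply: leq_trans ltv _; rewrite leq_mul2r leqnSn orbT.
    have [ev1 _ _] := zP _ ltj0; have [ev2 _ _] := zP _ ltj.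
    rewrite (event_back q_gt0 ev1 (ltnW ltj0) ltv).
    rewrite (event_back q_gt0 ev2 ltj0 ltv').
    by have /agreeP := Aq _ _ ltj0 ltj; apply; rewrite ltn_mod.
  rewrite (subnK (mqX _ _ ltj0 (ltnW ltj0))).
  have -> : nth 0 z j.+1 - j.+1 * q + j * q = nth 0 z j.+1 - q.
    have := mqX j.+1 j.+1 ltj (ltnW ltj).
    by rewrite mulSn; move: (j * q) => k; clear; lia.
  rewrite (lastq _ ltj) -(lastq _ ltj0).
  by move: neq; rewrite neq_ltn nlt.
Qed.

Definition all_events := flatten [seq events q | q <- iota 1 n.-1].

Lemma size_events q : 0 < q < n -> size (events q) <= n.-1 * (2 * size factors).
Proof.
move=> hq; have q_gt0 : 0 < q by case/andP: hq.
have -> : 2 * size factors = size (allpairs pair factors [:: true; false]).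
  by rewrite size_allpairs mulnC.
apply: (@fibre_leq _ _ _ (fun X => (factor x (X - n) n, x X < x (X - q)))).
  move=> X; rewrite mem_filter => /andP[/and4P[leX ltX _ _] _].
  apply: allpairs_f; last by case: (_ < _).
  have le_nX : n <= X.
    by apply: leq_trans leX; rewrite -mulnA mulnCA leq_pmulr // muln_gt0.
  rewrite mem_undup; apply/mapP; exists (X - n) => //.
  by rewrite mem_filter mem_iota; move: le_nX ltX; clear; lia.
by move=> [w b]; apply: event_fibre.
Qed.

Lemma size_all_events : size all_events <= n.-1 * (n.-1 * (2 * size factors)).
Proof.
rewrite /all_events size_flatten /shape -map_comp sumnE big_map.
apply: (@leq_trans (\sum_(q <- iota 1 n.-1) n.-1 * (2 * size factors))).
  rewrite big_seq [X in _ <= X]big_seq; apply: leq_sum => q.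
  by rewrite mem_iota => hq; apply: size_events; move: hq n_gt1; clear; lia.
by rewrite big_const_seq count_predT size_iota iter_addn_0 mulnC.
Qed.

(** A stretch lasts up to the first position that violates the period, or to the
    end of the text. *)
Lemma run_end i q : 0 < q -> run i q -> i + 2 * n * q <= N ->
  exists X, [/\ i + 2 * n * q <= X <= N, agree x i (i + q) (X - i - q)
              & X < N -> event q X].
Proof.
move=> q_gt0 rn leN.
pose P X := (i + 2 * n * q <= X) && ((X == N) || (x X != x (X - q))).
have exP : exists X, P X by exists N; rewrite /P leN eqxx.
have [X /andP[leX endX] minX] := ex_minnP exP.
have leXN : X <= N by apply: minX; rewrite /P leN eqxx.
have e1 : 2 * n * q = q + (2 * n - 1) * q by move: n_gt0; clear; nia.
have A : agree x i (i + q) (X - i - q).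
  apply/agreeP => v ltv; have [ltv'|lev] := ltnP v ((2 * n - 1) * q).
    by move/agreeP: rn; apply.
  have ltX : i + q + v < X by move: ltv; clear; lia.
  have := contra (minX (i + q + v)); rewrite -ltnNge => /(_ ltX).
  rewrite /P negb_and negb_or negbK e1 => /orP[|/andP[_ /eqP ->]].
    by move: lev; clear; lia.
  by congr x; clear; lia.
exists X; split; rewrite ?leX // => ltXN.
have neq : x X != x (X - q) by case/orP: endX => // /eqP eX; rewrite eX ltnn in ltXN.
rewrite /event ltXN neq andbT (leq_trans _ leX) ?leq_addl //=.
have e3 : X - 2 * n * q = i + (X - 2 * n * q - i) by move: leX; clear; lia.
have := agree_shift (s := X - 2 * n * q - i) _ A.
have e4 : i + q + (X - 2 * n * q - i) = X - 2 * n * q + q.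
  by move: leX; clear; lia.
have e5 : X - i - q - (X - 2 * n * q - i) = (2 * n - 1) * q.
  by move: leX; rewrite e1; move: (_ * q) => m; clear; lia.
rewrite -e3 e4 e5 /run; apply.
by move: leX; rewrite e1; move: (_ * q) => m; clear; lia.
Qed.

Lemma run_event_inj i i' q X : perfree x n i' -> 0 < q < n -> i < i' ->
  i'.+1 + 2 * n * q <= X -> agree x i.+1 (i.+1 + q) (X - i.+1 - q) -> False.
Proof.
move=> /perfreeP/(_ q) pf hq lti leX A; have := pf hq; rewrite /run.
have := agree_shift (s := i' - i.+1) _ A.
have -> : i.+1 + (i' - i.+1) = i' by move: lti; clear; lia.
have -> : i.+1 + q + (i' - i.+1) = i' + q by move: lti; clear; lia.
have e1 : 2 * n * q = q + (2 * n - 1) * q by move: n_gt0; clear; nia.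
move: leX; rewrite e1; move: (_ * q) => m leX H.
have {}H := H _; rewrite (agree_leq _ (H _)) //; move: leX lti; clear; lia.
Qed.

Variable K : nat.
Hypothesis le_nK : 2 * n * n <= K.

Definition free i := perfree x n i && (i + K <= N).

Lemma nfree_run i : ~~ free i -> i + K <= N ->
  exists q X, [/\ 0 < q < n, i + 2 * n * q <= X <= N,
    agree x i (i + q) (X - i - q) & X < N -> event q X].
Proof.
rewrite /free => nf leN; move: nf; rewrite leN andbT => /allPn[q].
rewrite mem_iota => hq; rewrite negbK => rn.
have hq' : 0 < q < n by move: hq n_gt1; clear; lia.
have leN' : i + 2 * n * q <= N.
  apply: leq_trans leN; rewrite leq_add2l; apply: leq_trans le_nK.
  by rewrite leq_mul2l; apply/orP; right; case/andP: hq' => _ /ltnW.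
have [X [h1 h2 h3]] := run_end (proj1 (andP hq')) rn leN'.
by exists q, X; split.
Qed.

(** A free position followed by one which is not free is recovered from the
    period stretch that begins behind it, that is from the period and the
    place where the stretch breaks off; n of these stretches, or the boundary
    i + K = N, run to the end of the text. *)
Lemma size_ends : size (ends N free) <= n + size all_events.
Proof.
pose t := (0, N) :: [seq (q, N) | q <- iota 1 n.-1]
            ++ flatten [seq [seq (q, X) | X <- events q] | q <- iota 1 n.-1].
have -> : n + size all_events = size t.
  rewrite /= size_cat size_map size_iota !size_flatten /shape -!map_comp.
  rewrite -addSn prednK //; congr (_ + sumn _).
  by apply: eq_map => q /=; rewrite size_map.
pose r i (c : nat * nat) := if c.1 == 0 then i + K == N else
  [&& 0 < c.1 < n, i.+1 + 2 * n * c.1 <= c.2 & agree x i.+1 (i.+1 + c.1) (c.2 - i.+1 - c.1)].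
apply: (@leq_size_rel _ _ _ r).
- by rewrite filter_uniq ?iota_uniq.
- move=> i; rewrite mem_filter => /andP[/andP[fi nfi] _].
  have [eN|neN] := eqVneq (i + K) N.
    by apply/hasP; exists (0, N); rewrite ?mem_head // /r /= eN.
  have leN : i.+1 + K <= N by case/andP: fi neN => _; clear; lia.
  have [q [X [hq /andP[leX leXN] A ev]]] := nfree_run nfi leN.
  have qi : q \in iota 1 n.-1 by rewrite mem_iota; move: hq; clear; lia.
  apply/hasP; exists (q, X); last first.
    by rewrite /r /= hq leX A; case: eqP hq => [->|].
  rewrite inE mem_cat; apply/orP; right.
  have [eX|neX] := eqVneq X N; first by rewrite eX map_f.
  apply/orP; right; apply/flattenP; exists [seq (q, X) | X <- events q].
    by apply/mapP; exists q.
  have ltX : X < N by rewrite ltn_neqAle neX.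
  by rewrite map_f // mem_filter ev // mem_iota.
- move=> i i' [q X]; rewrite !mem_filter => /andP[/andP[fi _] _] /andP[/andP[fi' _] _].
  rewrite /r /=; case: eqP => [_ /eqP e1 /eqP e2|_]; first by move: e1 e2; clear; lia.
  move=> /and3P[hq leX A] /and3P[_ leX' A']; case: (ltngtP i i') => // lt; exfalso.
    by apply: (run_event_inj _ hq lt leX' A); case/andP: fi'.
  by apply: (run_event_inj _ hq lt leX A'); case/andP: fi.
Qed.

Definition is_event X := has (event^~ X) (iota 1 n.-1).

Lemma count_events : count is_event (iota 1 N) <= size all_events.
Proof.
rewrite -size_filter; apply: uniq_leq_size; first by rewrite filter_uniq ?iota_uniq.
move=> X; rewrite mem_filter => /andP[/hasP[q qi ev] _].
apply/flattenP; exists (events q); first exact: map_f.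
by rewrite mem_filter ev mem_iota; case/and4P: ev.
Qed.

(** A tile (q, k) is the k-th power of a word of length q. *)
Fixpoint tiles i (ps : seq (nat * nat)) :=
  if ps is (q, k) :: ps' then
    [&& 0 < q < n, 0 < k, agree x i (i + q) (q * k - q) & tiles (i + q * k) ps']
  else i == N.

(** Free positions are tiles of one letter. From another position on, a whole
    period stretch is covered by the power of a word shorter than n and one
    remainder; it is charged to the place where the stretch breaks off. What is
    left at the end of the text costs at most K tiles. *)
Lemma tiling i : i <= N -> exists2 ps, tiles i ps &
  size ps <= count free (iota i (N - i)) + 2 * count is_event (iota i.+1 (N - i)) + K.
Proof.
have K_ge2 : 2 <= K by apply: leq_trans le_nK; move: n_gt1; clear; nia.
have [m] := ubnP (N - i); elim: m i => // m IH i ltm leiN.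
have [eiN|neiN] := eqVneq i N; first by exists [::] => //=; apply/eqP.
have ltiN : i < N by rewrite ltn_neqAle neiN.
have letter ps : tiles i.+1 ps -> tiles i ((1, 1) :: ps).
  by move=> tps; rewrite /= n_gt1 ?muln1 ?subnn /= ?addn1.
have eNi : N - i = (N - i.+1).+1 by move: ltiN; clear; lia.
have [fi|nfi] := boolP (free i).
  have [|ps tps szp] := IH i.+1 _ ltiN; first by move: ltm ltiN; clear; lia.
  exists ((1, 1) :: ps); first exact: letter.
  by move: szp; rewrite eNi /= fi; clear; lia.
have [leN|gtN] := leqP (i + K) N; last first.
  have [ps tps szp] : exists2 ps, tiles i ps & size ps = N - i.
    have : N - (N - i) = i by move: leiN; clear; lia.
    move: (N - i) (leq_subr i N) => d; elim: d (i) => [|d IHd] j led ej.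
      by exists [::] => //=; rewrite -ej subn0.
    have [|ps tps szp] := IHd j.+1 (ltnW led); first by move: led ej; clear; lia.
    exists ((1, 1) :: ps); last by rewrite /= szp.
    by rewrite /= n_gt1 ?muln1 ?subnn /= ?addn1.
  by exists ps => //; rewrite szp; move: gtN; clear; lia.
have [q [X [hq /andP[leX leXN] A ev]]] := nfree_run nfi leN.
have q_gt0 : 0 < q by case/andP: hq.
pose k := (X - i) %/ q; pose r := (X - i) %% q.
have eX : X - i = k * q + r by exact: divn_eq.
have lt_iX : i + q <= X.
  by apply: leq_trans leX; rewrite leq_add2l leq_pmull // muln_gt0.
have k_gt0 : 0 < k by rewrite divn_gt0 //; move: lt_iX; clear; lia.
have join ps : tiles X ps ->
    exists2 ps', tiles i ps' & size ps' <= (size ps).+2.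
  move=> tps; pose ps1 := if r == 0 then ps else (r, 1) :: ps.
  exists ((q, k) :: ps1); last by rewrite /ps1; case: ifP => /=; clear; lia.
  rewrite /= hq k_gt0 /=; apply/andP; split.
    by apply: agree_leq A; rewrite mulnC; move: eX; clear; lia.
  have eiX : X = i + q * k + r by rewrite mulnC; move: eX lt_iX; clear; lia.
  rewrite /ps1; have [r0|rn0] := eqVneq r 0; first by rewrite eiX r0 addn0 in tps.
  rewrite /= lt0n rn0 ?muln1 ?subnn /= -eiX tps andbT.
  by apply: ltn_trans (ltn_pmod _ q_gt0) _; case/andP: hq.
have [eXN|neXN] := eqVneq X N.
  have [|ps' tps' szp] := join [::]; first by rewrite /= eXN.
  by exists ps' => //; apply: leq_trans szp _; move: K_ge2 => /=; clear; lia.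
have ltXN : X < N by rewrite ltn_neqAle neXN.
have [|ps tps szp] := IH X _ leXN; first by move: ltm lt_iX q_gt0 leXN; clear; lia.
have [ps' tps' szp'] := join ps tps.
exists ps' => //; apply: leq_trans szp' _.
have e1 : N - i = (X - i) + (N - X) by move: leXN lt_iX; clear; lia.
have e2 : N - i = (X - i.+1) + (N - X).+1.
  by move: leXN lt_iX q_gt0; clear; lia.
have h1 : count free (iota X (N - X)) <= count free (iota i (N - i)).
  rewrite e1 iotaD count_cat subnKC; first exact: leq_addl.
  by move: lt_iX; clear; lia.
have h2 : count is_event (iota X.+1 (N - X)) < count is_event (iota i.+1 (N - i)).
  rewrite e2 iotaD count_cat subnKC; last by move: lt_iX q_gt0; clear; lia.
  rewrite /= (_ : is_event X); first by clear; lia.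
  by apply/hasP; exists q; rewrite ?ev // mem_iota; move: hq; clear; lia.
by move: szp h1 h2; clear; lia.
Qed.

End Runs.

(** * The number of tiles *)

Lemma leq_exp m m' e : m <= m' -> m ^ e <= m' ^ e.
Proof. by move=> le_m; elim: e => // e IH; rewrite !expnS leq_mul. Qed.

Lemma cube_gap p k : p < k -> 2 * k <= 3 * p -> p ^ 3 + 2 * k + 1 <= k ^ 3.
Proof.
by move=> lt_pk le_k; apply: leq_trans (leq_exp 3 lt_pk); rewrite !expnS expn0; nia.
Qed.

Section Bound.
Variables (x : nat -> nat) (N n l a : nat).
Hypotheses (n_gt1 : 1 < n) (l_gt0 : 0 < l) (le_na : n <= 3 ^ a).
Hypothesis ndiv : ~ divided x N n.
Hypothesis x_lt : forall i, i < N -> x i < l.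

Let n_gt0 : 0 < n. Proof. exact: ltnW. Qed.

Definition factor_bound := 2 * n ^ 2 * l * (3 * n ^ 6) ^ a.

(** Here the domain consists of all positions with n letters left. There are at
    most n^2 l first occurrences of one letter, and a triplings lead to
    length n. *)
Lemma size_factors : size (factors x N n) <= factor_bound.
Proof.
pose om i := i + n <= N; pose chi := colour x n om.
have om_lt i : om i -> i < N.+1 by rewrite /om; clear; lia.
have chi_lt i : om i -> chi i < n * n.
  by move=> omi; apply: colour_lt omi _ => z; apply: truncated_width.
have chi_mono i j : om i -> i < j -> chi i = chi j -> ~~ wgt x i j n.
  exact: colour_mono.
have size_ends1 : size (ends N.+1 om) <= 1.
  have -> : 1 = size [:: N - n] by [].
  apply: uniq_leq_size; first by rewrite filter_uniq ?iota_uniq.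
  move=> i; rewrite mem_filter mem_seq1 /= /om => /andP[/andP[h1 h2] _].
  by apply/eqP; move: h1 h2; rewrite -ltnNge; clear; lia.
have start : size (breaks x N.+1 om chi 1) <= n * n * l.
  have -> : l = size [seq [:: c] | c <- iota 0 l] by rewrite size_map size_iota.
  apply: (breaks_leq_factors om_lt chi_lt) => i omi.
  apply/mapP; exists (x i); last by rewrite /factor /mkseq /= addn0.
  by rewrite mem_iota x_lt //; move: omi n_gt0; rewrite /om; clear; lia.
have := iterated_tripling om_lt chi_lt chi_mono a n_gt0.
have -> : minn (3 ^ a * 1) n = n by rewrite muln1; apply/minn_idPr.
have := factors_leq_breaks x chi om_lt n; rewrite -/(factors x N n).
move=> h1 h2; apply: leq_trans h1 _.
apply: (@leq_trans (size (breaks x N.+1 om chi n) + size (ends N.+1 om) + 1)).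
  by rewrite -addnA leq_addr.
apply: leq_trans h2 _; apply: leq_mul.
  have -> : 2 * n ^ 2 * l = 2 * (n * n * l) by rewrite mulnn mulnA.
  move: start size_ends1.
  have : 4 <= n * n * l.
    by apply: leq_trans (leq_mul n_gt1 n_gt1) _; rewrite leq_pmulr.
  by move: (n * n * l) => m; clear; lia.
apply: leq_exp.
have -> : n ^ 6 = (n * n) ^ 3 by rewrite mulnn -expnM.
have : 2 <= n * n by apply: leq_trans n_gt1 _; rewrite leq_pmull.
have : n <= n * n by rewrite leq_pmull.
move: (n * n) => m; rewrite !expnS expn0; clear; nia.
Qed.

Let P := 20 * n ^ 2.
Let K := 27 * n ^ 2.

(** Here the domain consists of the free positions, with P = 20n^2 colours. The
    length K = 27n^2 exceeds P by enough for cube_gap, and a + 3 triplings lead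
    from length n to K, since 3^(a + 3) n >= 27n^2. *)
Lemma tiling_bound : exists2 ps, tiles x N n 0 ps &
  size ps <= 60 * n ^ 3 *
    (24 * (n ^ 2 * factor_bound) * ((27 * n ^ 2) ^ 3) ^ (a + 3)).
Proof.
have sq_n : 2 * n <= n ^ 2 by rewrite leq_mul2r n_gt1 orbT.
pose om := free x N n K; pose chi := colour x K om.
have le_nnK : 2 * n * n <= K by rewrite /K -mulnA mulnn leq_mul2r orbT.
have le_nK : n <= K by move: sq_n; rewrite /K; move: (n ^ 2) => m; clear; lia.
have P_gt0 : 0 < P by rewrite /P muln_gt0 expn_gt0 n_gt0.
have lt_PK : P < K by rewrite ltn_mul2r expn_gt0 n_gt0.
have om_N i : om i -> i + K <= N by case/andP.
have om_lt i : om i -> i < N by move/om_N; move: P_gt0 lt_PK; clear; lia.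
have chi_lt i : om i -> chi i < P.
  move=> omi; apply: colour_lt omi _ => z srt al.
  apply: leq_trans (perfree_width ndiv n_gt0 srt al) _.
  by rewrite /P -mulnn; clear; nia.
have chi_mono i j : om i -> i < j -> chi i = chi j -> ~~ wgt x i j K.
  exact: colour_mono.
have om_pf i g : om i -> 0 < g -> i + 2 * n * g <= N ->
    ~~ agree x i (i + g) ((2 * n - 1) * g).
  move=> /andP[pf _] g_gt0 leN; apply/negP => A; apply: ndiv.
  exact: power_divided g_gt0 n_gt0 leN pf A.
pose F := factor_bound; pose Z := (K ^ 3) ^ (a + 3).
have F_gt0 : 0 < F by rewrite !muln_gt0 !expn_gt0 muln_gt0 expn_gt0 n_gt0 l_gt0.
have Z_gt0 : 0 < Z by rewrite !expn_gt0 muln_gt0 expn_gt0 n_gt0.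
have le_F : size (factors x N n) <= F := size_factors.
have le_ev : size (all_events x N n) <= 2 * n ^ 2 * F.
  apply: leq_trans (size_all_events n_gt1 ndiv) _.
  apply: (@leq_trans (n * (n * (2 * F)))); last by rewrite -mulnn; clear; nia.
  by rewrite !leq_mul ?leq_pred.
have le_E := size_ends x N n_gt1 le_nnK.
have le_Bn : size (breaks x N om chi n) <= P * size (factors x N n).
  apply: (breaks_leq_factors om_lt chi_lt) => i omi.
  rewrite mem_undup; apply/mapP; exists i => //; rewrite mem_filter mem_iota /=.
  by move: (om_N _ omi) le_nK; clear; lia.
have le_BK := iterated_tripling om_lt chi_lt chi_mono (a + 3) le_nK.
have eK : minn (3 ^ (a + 3) * n) K = K.
  apply/minn_idPr; rewrite /K -mulnn mulnA leq_mul2r; apply/orP; right.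
  by rewrite expnD [27 * n]mulnC; apply: leq_mul.
rewrite {}eK in le_BK.
have le_Z : (P ^ 3 + 2 * K + 1) ^ (a + 3) <= Z.
  apply: leq_exp; have : 2 * K <= 3 * P.
    by rewrite /K /P; move: (n ^ 2) => m; clear; lia.
  exact: cube_gap.
have le_om := size_om_leq om_lt chi_lt chi_mono n_gt0 P_gt0 lt_PK om_N om_pf.
have [ps tps szp] := tiling x n_gt1 le_nnK (leq0n N).
exists ps => //; apply: leq_trans szp _.
rewrite subn0 -size_filter; have := count_events x N n.
move: le_om le_BK; rewrite -/om.
set A := size (filter om _); set B := size (breaks _ _ _ _ K).
set B' := size (breaks _ _ _ _ n) in le_Bn *.
set E := size (ends _ _) in le_E *.
set ev := size (all_events _ _ _) in le_ev le_E *.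
set f := size (factors _ _ _) in le_Bn le_F *.
move=> le_om le_BK le_c.
pose q := n ^ 2; pose T := 23 * (q * F).
have le_T : B' + E + 1 <= T.
  have : 2 * n <= q * F by apply: leq_trans sq_n _; rewrite leq_pmulr.
  have : B' <= 20 * (q * F).
    by apply: leq_trans le_Bn _; rewrite /P -mulnA leq_mul2l leq_mul2l le_F !orbT.
  move: le_ev le_E n_gt1; rewrite -/q -mulnA /T; move: (q * F) => m; clear; lia.
have le_BE : E + B <= T * Z.
  apply: leq_trans (leq_mul le_T le_Z); apply: leq_trans le_BK.
  by clear; lia.
have le_L : (2 * n + 1) * P <= 60 * n ^ 3.
  have -> : n ^ 3 = n * n ^ 2 by rewrite -expnS.
  by rewrite /P; move: (n ^ 2) n_gt1 => m; clear; nia.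
have le_A : A <= 60 * n ^ 3 * (T * Z) by apply: leq_trans le_om (leq_mul le_L le_BE).
have le_rest : 2 * count (is_event x N n) (iota 1 N) + K <= 60 * n ^ 3 * (q * F * Z).
  have h1 : 2 * count (is_event x N n) (iota 1 N) + K <= 31 * (q * F).
    have : q <= q * F by rewrite leq_pmulr.
    move: le_c le_ev; rewrite -/q -mulnA /K -/q; move: (q * F) => m; clear; lia.
  apply: leq_trans h1 _; apply: leq_mul; last by rewrite leq_pmulr.
  have : 0 < n ^ 3 by rewrite expn_gt0 n_gt0.
  by move: (n ^ 3) => m; clear; lia.
rewrite -addnA; apply: leq_trans (leq_add le_A le_rest) _.
rewrite -/K -/Z -/F -/q -mulnDr leq_mul2l /T.
by apply/orP; right; move: (q * F) => m; clear; nia.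
Qed.

End Bound.

(** * Words as texts *)

Section Text.
Variable l : nat.
Implicit Types w u v : seq 'I_l.

Definition text w i := nth 0 (map (@nat_of_ord l) w) i.

Definition slice w i m := take m (drop i w).

(** The value in base l: on words of equal length this is the lexicographic
    order, and it is a natural number to do induction on. *)
Fixpoint code w := if w is c :: w' then c * l ^ size w' + code w' else 0.

Lemma code_lt w : code w < l ^ size w.
Proof.
elim: w => //= c w IH; rewrite expnS.
have := ltn_ord c; move: (size w) IH => s IH ltc; apply: leq_trans (_ : c.+1 * l ^ s <= _).
  by rewrite mulSn addnC ltn_add2r.
by rewrite leq_mul2r ltc orbT.
Qed.

Lemma code_catl w u v :
  size u = size v -> code u < code v -> code (w ++ u) < code (w ++ v).
Proof.
move=> esz lt_uv; elim: w => //= c w IH.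
by rewrite !size_cat esz ltn_add2l.
Qed.

Lemma code_lt_text u v t : size u = size v -> t < size u ->
  (forall i, i < t -> text u i = text v i) -> text u t < text v t ->
  code u < code v.
Proof.
elim: u v t => [|a u IH] [|b v] // t [esz] ltt eqt ltt'.
case: t ltt eqt ltt' => [_ _|t ltt eqt ltt'].
  rewrite /text /= => lt_ab; rewrite esz.
  have := code_lt u; rewrite esz => ltu.
  apply: leq_trans (leq_addr _ _); apply: leq_trans (_ : a.+1 * l ^ size v <= _).
    by rewrite mulSn addnC ltn_add2r.
  by rewrite leq_mul2r lt_ab orbT.
have eab : a = b by apply: val_inj; apply: (eqt 0).
rewrite /= eab esz ltn_add2l; apply: IH ltt _ ltt' => // i lti.
exact: (eqt i.+1).
Qed.

Lemma text_lt w i : i < size w -> text w i < l.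
Proof.
case: w => // c w lti; rewrite /text (nth_map c) //; exact: ltn_ord.
Qed.

Lemma text_slice w p m i : i < m -> text (slice w p m) i = text w (p + i).
Proof. by move=> ltm; rewrite /text /slice map_take map_drop nth_take // nth_drop. Qed.

Lemma text_catl u v i : i < size u -> text (u ++ v) i = text u i.
Proof. by move=> lti; rewrite /text map_cat nth_cat size_map lti. Qed.

Lemma size_slice w p m : p + m <= size w -> size (slice w p m) = m.
Proof. by move=> le_w; rewrite size_takel // size_drop; lia. Qed.

Lemma slice_cat w p m m' : slice w p (m + m') = slice w p m ++ slice w (p + m) m'.
Proof. by rewrite /slice takeD drop_drop addnC. Qed.

Lemma slice_agree w p q m : p + m <= size w -> q + m <= size w ->
  agree (text w) p q m -> slice w p m = slice w q m.
Proof.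
move=> lep leq /agreeP A; apply: (inj_map (@ord_inj l)).
apply: (@eq_from_nth _ 0); rewrite !size_map !size_slice // => i lti.
by have := A i lti; rewrite -!(@text_slice _ _ m).
Qed.

(** In any rearrangement of an increasing sequence, the first displaced entry is
    replaced by a larger one. *)
Lemma first_difference n (e t : seq 'I_n) :
  sorted (fun i j : 'I_n => i < j) e -> perm_eq t e -> t != e ->
  exists s k j r r', [/\ e = s ++ k :: r, t = s ++ j :: r' & k < j].
Proof.
elim: e t => [|a e IH] [|b t] // srt.
- by move/perm_size.
- by move/perm_size.
have [->|ne] := eqVneq b a.
  rewrite perm_cons eqseq_cons eqxx /= => pe ne_te.
  have [s [k [j [r [r' [-> -> lt]]]]]] := IH t (path_sorted srt) pe ne_te.
  by exists (a :: s), k, j, r, r'.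
move=> pe _; exists [::], a, b, e, t; split=> //.
have : b \in a :: e by rewrite -(perm_mem pe) mem_head.
rewrite inE (negPf ne) /= => /(allP (order_path_min _ srt)); apply.
by move=> i j k; apply: ltn_trans.
Qed.

Lemma flatten_slices w (p : nat -> nat) a b : (forall k, p k <= p k.+1) ->
  flatten [seq slice w (p k) (p k.+1 - p k) | k <- iota a b]
    = slice w (p a) (p (a + b) - p a).
Proof.
move=> p_le; elim: b a => [|b IH] a; first by rewrite addn0 subnn /slice take0.
have p_mono k k' : k <= k' -> p k <= p k' by apply: (homo_leq leqnn (@leq_trans) p_le).
rewrite /= IH addSnnS.
have := p_mono a.+1 (a + b.+1); rewrite addnS ltnS leq_addr => /(_ isT) h.
have -> : p (a + b).+1 - p a = (p a.+1 - p a) + (p (a + b).+1 - p a.+1).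
  by have := p_le a; lia.
by rewrite slice_cat subnKC.
Qed.

(** The form of a word to which one step of straightening applies: the identity
    replaces it by words of smaller code. *)
Definition reducible n w :=
  exists pre (U : 'I_n -> seq 'I_l),
    [/\ w = pre ++ flatten (map U (enum 'I_n)), forall k, U k != [::]
      & forall t, perm_eq t (enum 'I_n) -> t != enum 'I_n ->
          code (pre ++ flatten (map U t)) < code w].

(** The pieces extend from the beginning of each factor to the beginning of the
    next one. At the first change of order some piece k is replaced by a later
    piece j, which is smaller within the factors that the pieces contain. *)
Lemma divided_reducible n w :
  1 < n -> divided (text w) (size w) n -> reducible n w.
Proof.
move=> n_gt1 [s [sz srt /allP ends_s]]; set N := size w in ends_s.
pose p k := if k < n then (nth (0, 0) s k).1 else N.
have sP k : k < n -> (nth (0, 0) s k).1 + (nth (0, 0) s k).2 <= N.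
  by move=> ltk; apply: ends_s; rewrite mem_nth ?sz.
have s_follows j k : j < k < n -> follows (text w) (nth (0, 0) s j) (nth (0, 0) s k).
  move=> /andP[ltjk ltk].
  apply: (sorted_ltn_nth (@follows_trans (text w))) => //; rewrite inE sz //.
  exact: ltn_trans ltk.
have room k : k < n -> p k + (nth (0, 0) s k).2 <= p k.+1.
  rewrite /p => ltk; rewrite ltk; case: ifP => [ltk1|_]; last exact: sP.
  have h : k < k.+1 < n by rewrite ltnSn ltk1.
  by have /andP[] := s_follows _ _ h.
have p_le k : p k <= p k.+1.
  have [ltk|lek] := ltnP k n; first exact: leq_trans (leq_addr _ _) (room k ltk).
  by rewrite /p ltnNge lek ltnNge (leqW lek).
have p_mono k k' : k <= k' -> p k <= p k' by apply: (homo_leq leqnn (@leq_trans) p_le).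
have pn : p n = N by rewrite /p ltnn.
have p_N k : k < n -> p k.+1 <= N by move=> ltk; rewrite -pn; apply: p_mono.
have s_pos k : k < n -> 0 < (nth (0, 0) s k).2.
  move=> ltk; have [k0|k_gt0] := posnP k.
    have /andP[_ /wgtP[t]] := s_follows 0 1 n_gt1.
    by rewrite leq_min k0 => /andP[h _] _; apply: leq_ltn_trans h.
  have h : 0 < k < n by rewrite k_gt0.
  have /andP[_ /wgtP[t]] := s_follows _ _ h.
  by rewrite leq_min => /andP[_ lt_t] _; apply: leq_ltn_trans lt_t.
pose U (k : 'I_n) := slice w (p k) (p k.+1 - p k).
have szU (k : 'I_n) : size (U k) = p k.+1 - p k.
  by rewrite size_slice // subnKC // p_N.
have ew : w = take (p 0) w ++ flatten (map U (enum 'I_n)).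
  have -> : map U (enum 'I_n) =
      [seq slice w (p k) (p k.+1 - p k) | k <- map val (enum 'I_n)].
    by rewrite -map_comp.
  rewrite val_enum_ord flatten_slices // add0n pn /slice [take (N - _) _]take_oversize.
    by rewrite cat_take_drop.
  by rewrite size_drop.
exists (take (p 0) w), U; split=> // [k|t pt nt].
  rewrite -size_eq0 szU subn_eq0 -ltnNge.
  by apply: leq_trans (room k (ltn_ord k)); rewrite -[X in X < _]addn0 ltn_add2l s_pos.
have srt_enum : sorted (fun i j : 'I_n => i < j) (enum 'I_n).
  by have := iota_ltn_sorted 0 n; rewrite -val_enum_ord sorted_map.
have [s0 [k [j [r [r' [e1 e2 lt_kj]]]]]] := first_difference srt_enum pt nt.
have sz_fl : size (flatten (map U t)) = size (flatten (map U (enum 'I_n))).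
  by apply: perm_size; apply: perm_flatten; apply: perm_map.
rewrite {2}ew; apply: code_catl => //.
move: sz_fl; rewrite e1 e2 !map_cat !flatten_cat /= => sz_fl; apply: code_catl.
  by move: sz_fl; rewrite !size_cat; lia.
have h : k < j < n by rewrite lt_kj ltn_ord.
have /andP[_ /wgtP[d]] := s_follows _ _ h.
rewrite leq_min => /andP[dk dj] /andP[/agreeP A lt_d].
have in_U (i : 'I_n) (u : nat) r0 : u <= d -> d < (nth (0, 0) s i).2 ->
    text (U i ++ r0) u = text w ((nth (0, 0) s i).1 + u).
  move=> leu ltd.
  have ltu : u < p i.+1 - p i by have := room i (ltn_ord i); lia.
  by rewrite text_catl ?szU // /U text_slice // /p ltn_ord.
apply: (code_lt_text (t := d)).
- by move: sz_fl; rewrite !size_cat; lia.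
- by rewrite size_cat szU; have := room j (ltn_ord j); lia.
- by move=> m ltm; rewrite !in_U ?A // ltnW.
- by rewrite !in_U.
Qed.

Lemma tiles_leq n x N i ps : tiles x N n i ps -> i <= N.
Proof.
elim: ps i => [|[q k] ps IH] i /=; first by move/eqP->.
by case/and4P => _ _ _ /IH; apply: leq_trans; exact: leq_addr.
Qed.

Lemma slice_power w i q k : 0 < k -> i + q * k <= size w ->
  agree (text w) i (i + q) (q * k - q) ->
  flatten (nseq k (slice w i q)) = slice w i (q * k).
Proof.
elim: k i => // -[|k] IH i _ le_w A; first by rewrite /= muln1 cats0.
rewrite mulnS slice_cat; congr (_ ++ _).
rewrite mulnS addKn in A; rewrite mulnS in le_w.
have le1 : i + q * k.+1 <= size w by move: le_w; lia.
have le2 : i + q + q * k.+1 <= size w by move: le_w; lia.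
rewrite -(slice_agree le1 le2 A); apply: IH => //.
by apply: agree_leq A; exact: leq_subr.
Qed.

Lemma tiles_word n w i ps : tiles (text w) (size w) n i ps ->
  exists qs : seq (seq 'I_l * nat),
    [/\ size qs = size ps, forall p, p \in qs -> 0 < size p.1 < n /\ 0 < p.2
      & flatten [seq flatten (nseq p.2 p.1) | p <- qs] = drop i w].
Proof.
elim: ps i => [|[q k] ps IH] i /=.
  by move/eqP->; exists [::]; rewrite drop_size.
case/and4P => hq k_gt0 A tps; have le_w := tiles_leq tps.
have [qs [szq okq eqq]] := IH _ tps.
exists ((slice w i q, k) :: qs); split=> /=.
- by rewrite szq.
- move=> p; rewrite inE => /orP[/eqP->|/okq //] /=.
  by rewrite size_slice // (leq_trans _ le_w) // leq_add2l leq_pmulr.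
- by rewrite eqq slice_power // /slice addnC -drop_drop cat_take_drop.
Qed.

End Text.

Local Open Scope ring_scope.

(** * Products without a unit *)

Section Products.
Variables (K : fieldType) (A : lmodType K) (mul : {bilinear A -> A -> A}).
Hypothesis mulA : associative mul.

Lemma foldl_mul x s y : foldl mul (mul x y) s = mul x (foldl mul y s).
Proof. by elim: s y => //= z s IH y; rewrite -mulA IH. Qed.

Lemma mprod_cat s t : s != [::] -> t != [::] ->
  mprod mul (s ++ t) = mul (mprod mul s) (mprod mul t).
Proof. by case: s t => // x s [//|y t] _ _; rewrite /= foldl_cat /= foldl_mul. Qed.

Lemma mprod_cons x s : s != [::] -> mprod mul (x :: s) = mul x (mprod mul s).
Proof. exact: (@mprod_cat [:: x]). Qed.

Lemma mprod_flatten ss : all (fun s => s != [::]) ss ->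
  mprod mul (flatten ss) = mprod mul (map (mprod mul) ss).
Proof.
elim: ss => //= s ss IH /andP[s_n0 al].
have [->|ss_n0] := eqVneq ss [::]; first by rewrite /= cats0.
have fl_n0 : flatten ss != [::] by case: ss al ss_n0 {IH} => //= -[].
rewrite mprod_cat // IH // -mprod_cons //.
by case: ss ss_n0 {IH al fl_n0}.
Qed.

End Products.

(** * Multilinear identities *)

Section Multilinear.
Variables (K : fieldType) (A : lmodType K) (mul : {bilinear A -> A -> A}).
Hypothesis mulA : associative mul.
Variables (n : nat) (lab : 'I_n -> nat).

(** The sequences of indices whose labels spell s. *)
Fixpoint labelled (s : seq nat) : seq (seq 'I_n) :=
  if s is k :: s' then
    [seq j :: t | j <- [seq j <- enum 'I_n | lab j == k], t <- labelled s']
  else [:: [::]].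

Lemma mem_labelled s t : (t \in labelled s) = (map lab t == s).
Proof.
elim: s t => [|k s IH] [|j t] //=.
  by apply/allpairsP => -[[? ?] []].
rewrite eqseq_cons; apply/allpairsP/andP.
  case=> -[j' t'] /= []; rewrite mem_filter => /andP[e _]; rewrite IH => e'.
  by case=> -> ->.
case=> e e'; exists (j, t) => /=; split=> //; last by rewrite IH.
by rewrite mem_filter e mem_enum.
Qed.

Lemma labelled_uniq s : uniq (labelled s).
Proof.
elim: s => //= k s IH; apply: allpairs_uniq => //.
  by rewrite filter_uniq ?enum_uniq.
by move=> [j t] [j' t'] _ _ [-> ->].
Qed.

(** Substitution, for every variable k, of the sum of the y j with label k and
    j in S. *)
Lemma mprod_sums (S : {set 'I_n}) (y : 'I_n -> A) s :
  mprod mul [seq \sum_(j in S | lab j == k) y j | k <- s] =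
  \sum_(t <- labelled s | all (mem S) t) mprod mul (map y t).
Proof.
elim: s => [|k s IH]; first by rewrite /= big_cons big_nil addr0.
have e : \sum_(j in S | lab j == k) y j =
    \sum_(j <- [seq j <- enum 'I_n | lab j == k] | j \in S) y j.
  by rewrite big_filter_cond big_enum_cond; apply: eq_bigl => j; rewrite andbC.
rewrite [labelled _]/= big_mkcond big_allpairs_dep map_cons e.
have [->|s_n0] := eqVneq s [::].
  rewrite /= big_mkcond; apply: eq_bigr => j _.
  by rewrite big_seq1 andbT.
rewrite mprod_cons //; last by case: (s) s_n0.
rewrite IH linear_sumlz /= big_mkcond; apply: eq_bigr => j _.
have [jS|] := boolP (j \in S); last by rewrite big1.
rewrite linear_sumr big_mkcond !big_seq; apply: eq_bigr => t.
rewrite mem_labelled => /eqP et.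
rewrite andTb; case: ifP => // _.
by rewrite -[RHS]/(mprod mul (y j :: map y t)) mprod_cons //; case: (t) et s_n0 => // <-.
Qed.

Definition covers (t : seq 'I_n) := [forall j, j \in t].

(** Inclusion and exclusion: the alternating sum keeps only the products in which
    all of the y j occur. *)
Lemma signed_subsets (t : seq 'I_n) :
  \sum_(S : {set 'I_n} | all (mem S) t) \prod_j (if j \in S then 1 else -1)
    = (covers t)%:R :> K.
Proof.
pose G j : K := if j \in t then 0 else -1.
transitivity (\prod_j (1 + G j)).
  rewrite (@bigA_distr K 0 1 *%R +%R 'I_n (fun=> 1) G) big_mkcond /=.
  apply: eq_bigr => S _; case: ifP => [/allP St|/allPn[j jt jS]].
    apply: eq_bigr => j _; rewrite /G; case: ifP => // /negbT jS.
    by case: ifP => // /St; rewrite /= (negPf jS).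
  have jS' : (j \in S) = false by apply: negbTE.
  by rewrite (bigD1 j) //= jS' /G jt mul0r.
have [/forallP ct|/forallPn[j jt]] := boolP (covers t).
  by rewrite big1 // => j _; rewrite /G ct addr0.
by rewrite (bigD1 j) //= /G (negPf jt) subrr mul0r.
Qed.

Lemma covers_perm t : (size t <= n)%N -> covers t -> perm_eq t (enum 'I_n).
Proof.
move=> le_n /forallP ct.
have {}le_n : (size t <= size (enum 'I_n))%N by rewrite size_enum_ord.
have sub : {subset enum 'I_n <= t} by move=> j _; apply: ct.
have ut := leq_size_uniq (enum_uniq _) sub le_n.
by apply: uniq_perm => // [|j]; rewrite ?enum_uniq // mem_enum ct.
Qed.

End Multilinear.

(** Let m be a monomial of degree n with coefficient 1, and label the index j by
    the j-th variable of m, which may repeat. Every variable k is replaced by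
    the sum of the y j with label k over a subset S of the indices, and the
    results are added with alternating signs. Products that miss some y j
    cancel; as no monomial is longer than n, the others are the products of all
    y j in some order, and the natural order comes from m only. *)
Lemma multilinear_identity (K : fieldType) (A : lmodType K)
    (mul : {bilinear A -> A -> A}) (f : {malg K[{fmonom nat}]}) n :
  associative mul -> polynomial_identity mul f -> admissible f ->
  ncpoly_degree f = n ->
  exists cs : seq (K * seq 'I_n),
    (forall ct, ct \in cs -> perm_eq ct.2 (enum 'I_n) && (ct.2 != enum 'I_n)) /\
    forall y : 'I_n -> A, mprod mul (map y (enum 'I_n)) =
      \sum_(ct <- cs) ct.1 *: mprod mul (map y ct.2).
Proof.
move=> mulA [_ f_id] [m m_f [dm fm1]] degf.
have sz_m : size m = n by rewrite -degf -dm.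
have sz_le (m' : {fmonom nat}) : m' \in msupp f -> (size m' <= n)%N.
  move=> m'f; rewrite -degf /ncpoly_degree.
  by apply: (@leq_bigmax_seq _ _ xpredT (@fdeg nat) m' m'f isT).
pose lab (j : 'I_n) := nth 0%N m j.
have lab_enum : map lab (enum 'I_n) = m.
  rewrite (_ : map lab _ = map (nth 0%N m) (map val (enum 'I_n))).
    by rewrite val_enum_ord -sz_m map_nth_iota0 // take_size.
  by rewrite -map_comp.
have perm_cov (m' : {fmonom nat}) t : m' \in msupp f -> t \in labelled lab m' -> covers t ->
    perm_eq t (enum 'I_n).
  move=> /sz_le le_m'; rewrite mem_labelled => /eqP et; apply: covers_perm.
  by rewrite -(size_map lab) et.
exists [seq (- f@_m', t) | m' <- msupp f,
         t <- [seq t <- labelled lab m' | covers t && (t != enum 'I_n)]].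
split=> [ct /allpairsPdep[m' [t [m'f]]]|y].
  rewrite mem_filter => /andP[/andP[ct_t t_n] t_m'] -> /=.
  by rewrite (perm_cov m').
have total : \sum_(m' <- msupp f) \sum_(t <- labelled lab m' | covers t)
    f@_m' *: mprod mul (map y t) = 0.
  pose v (S : {set 'I_n}) k := \sum_(j in S | lab j == k) y j.
  pose sg (S : {set 'I_n}) : K := \prod_j (if j \in S then 1 else -1).
  transitivity (\sum_(S : {set 'I_n}) sg S *: ncpoly_eval mul (v S) f).
    rewrite /ncpoly_eval.
    under [RHS]eq_bigr => S _ do rewrite scaler_sumr.
    rewrite exchange_big /=; apply: eq_bigr => m' _.
    under [RHS]eq_bigr => S _ do
      rewrite (mprod_sums mulA lab S y m') scalerA mulrC -scalerA scaler_sumr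
        scaler_sumr big_mkcond.
    rewrite exchange_big big_mkcond /=; apply: eq_bigr => t _.
    rewrite -big_mkcond /=.
    under eq_bigr => S _ do rewrite scalerA mulrC -scalerA.
    rewrite -scaler_suml signed_subsets.
    by case: ifP; rewrite ?scale1r ?scale0r.
  by rewrite big1 // => S _; rewrite f_id scaler0.
pose g m' t := f@_m' *: mprod mul (map y t).
have main : \sum_(m' <- msupp f)
    \sum_(t <- labelled lab m' | covers t && (t == enum 'I_n)) g m' t
    = mprod mul (map y (enum 'I_n)).
  have cov_enum : covers (enum 'I_n) by apply/forallP => j; rewrite mem_enum.
  rewrite (bigD1_seq m) ?fset_uniq //= [X in _ + X]big1 => [|m' ne_m].
    rewrite addr0 (eq_bigl (pred1 (enum 'I_n))) => [|t]; last first.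
      by rewrite /= andb_idl // => /eqP ->.
    rewrite -big_filter filter_pred1_uniq ?labelled_uniq //.
      by rewrite big_seq1 /g fm1 scale1r.
    by rewrite mem_labelled lab_enum.
  rewrite big_seq_cond big1 // => t /andP[t_m' /andP[_ /eqP et]].
  move: t_m'; rewrite et mem_labelled lab_enum => /eqP em.
  by case/eqP: ne_m; apply/val_inj.
have eqz : \sum_(m' <- msupp f)
    (\sum_(t <- labelled lab m' | covers t && (t != enum 'I_n)) g m' t
     + \sum_(t <- labelled lab m' | covers t && (t == enum 'I_n)) g m' t) = 0.
  rewrite -[RHS]total; apply: eq_bigr => m' _.
  rewrite [RHS](bigID (fun t => t != enum 'I_n)) /=; congr (_ + _).
  by apply: eq_bigl => t; rewrite negbK.
move: eqz; rewrite big_split /= main => /eqP; rewrite addrC addr_eq0 => /eqP ->.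
rewrite big_allpairs_dep /= -sumrN; apply: eq_bigr => m' _.
rewrite -sumrN big_filter; apply: eq_bigr => t _.
by rewrite /g scaleNr.
Qed.

(** * Straightening of words *)

Section Reduction.
Variables (K : fieldType) (A : lmodType K) (mul : {bilinear A -> A -> A}).
Hypothesis mulA : associative mul.
Variables (l : nat) (a : 'I_l -> A).

Lemma word_val_cat u v : u != [::] -> v != [::] ->
  word_val mul a (u ++ v) = mul (word_val mul a u) (word_val mul a v).
Proof.
move=> u_n0 v_n0; rewrite /word_val map_cat mprod_cat //.
  by case: (u) u_n0.
by case: (v) v_n0.
Qed.

Lemma word_val_flatten ss : all (fun s => s != [::]) ss ->
  word_val mul a (flatten ss) = mprod mul (map (word_val mul a) ss).
Proof.
move=> ss_n0; rewrite /word_val map_flatten mprod_flatten //.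
  by rewrite -map_comp.
by rewrite all_map; apply: sub_all ss_n0 => -[].
Qed.

Lemma word_val_power u k : u != [::] ->
  word_val mul a (flatten (nseq k u)) = power mul (word_val mul a u) k.
Proof.
move=> u_n0; rewrite word_val_flatten; last by rewrite all_nseq u_n0 orbT.
by rewrite map_nseq.
Qed.

Lemma height_representation_sum Y h (I : eqType) (r : seq I) (c : I -> K) F :
  {in r, forall i, height_representation mul a Y h (F i)} ->
  height_representation mul a Y h (\sum_(i <- r) c i *: F i).
Proof.
elim: r => [|i r IH] Fr; first by exists [::]; rewrite !big_nil.
have [c1 [ok1 e1]] : height_representation mul a Y h (F i).
  by apply: Fr; rewrite mem_head.
have [j jr|c2 [ok2 e2]] := IH; first by apply: Fr; rewrite inE jr orbT.
exists ([seq (c i * t.1, t.2) | t <- c1] ++ c2); split=> [t|].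
  rewrite mem_cat => /orP[/mapP[t' /ok1 okt' -> //]|]; exact: ok2.
rewrite big_cons big_cat big_map /= -e2 e1 scaler_sumr; congr (_ + _).
by apply: eq_bigr => t _; rewrite scalerA.
Qed.

Section Straightening.
Variables (n : nat) (cs : seq (K * seq 'I_n)).
Hypothesis n_gt0 : (0 < n)%N.
Hypothesis cs_perm : forall ct, ct \in cs ->
  perm_eq ct.2 (enum 'I_n) && (ct.2 != enum 'I_n).
Hypothesis cs_id : forall y : 'I_n -> A, mprod mul (map y (enum 'I_n)) =
  \sum_(ct <- cs) ct.1 *: mprod mul (map y ct.2).

Lemma flatten_perm_neq0 (U : 'I_n -> seq 'I_l) t : (forall k, U k != [::]) ->
  perm_eq t (enum 'I_n) -> flatten (map U t) != [::].
Proof.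
move=> U_n0 /perm_size; rewrite size_enum_ord.
case: t => [sz_t|k t _] /=; first by move: n_gt0; rewrite -sz_t.
by have := U_n0 k; case: (U k).
Qed.

Lemma straightening pre (U : 'I_n -> seq 'I_l) : (forall k, U k != [::]) ->
  word_val mul a (pre ++ flatten (map U (enum 'I_n))) =
  \sum_(ct <- cs) ct.1 *: word_val mul a (pre ++ flatten (map U ct.2)).
Proof.
move=> U_n0.
have val_U t : word_val mul a (flatten (map U t)) =
    mprod mul (map (fun k => word_val mul a (U k)) t).
  rewrite word_val_flatten; first by rewrite -map_comp.
  by rewrite all_map; apply/allP => k _; apply: U_n0.
have [->|pre_n0] := eqVneq pre [::].
  by rewrite /= val_U cs_id; apply: eq_bigr => ct _; rewrite val_U.
rewrite word_val_cat ?flatten_perm_neq0 // val_U cs_id linear_sumr !big_seq.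
apply: eq_bigr => ct /cs_perm/andP[ct_p _].
by rewrite linearZr_LR /= word_val_cat ?flatten_perm_neq0 // val_U.
Qed.

(** By induction on the code: a reducible word is a combination of words of
    smaller code. *)
Lemma height_of_irreducible Y h :
  (forall w, w != [::] -> ~ reducible n w ->
     height_representation mul a Y h (word_val mul a w)) ->
  height_at_most mul a Y h.
Proof.
move=> irr w; have [m] := ubnP (code w); elim: m w => // m IH w lt_w w_n0.
have [[pre [U [ew U_n0 U_lt]]]|] := EM (reducible n w); last exact: irr.
rewrite ew straightening //; apply: height_representation_sum => ct /cs_perm.
case/andP=> ct_p ct_n; apply: IH; first exact: leq_trans (U_lt _ ct_p ct_n) _.
have := flatten_perm_neq0 U_n0 ct_p.
by case: (pre).
Qed.

End Straightening.

Lemma tiling_height n w ps : w != [::] ->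
  tiles (text w) (size w) n 0 ps ->
  forall h, (size ps <= h)%N ->
  height_representation mul a (short_words n l) h (word_val mul a w).
Proof.
move=> w_n0 /tiles_word[qs [szq okq eqq]] h le_h.
exists [:: (1, qs)]; split=> [t|].
  rewrite inE => /eqP -> /=; split; first by rewrite szq.
  by move=> p /okq[].
rewrite big_seq1 scale1r /= -[in LHS](drop0 w) -eqq word_val_flatten.
  rewrite -map_comp; congr mprod; apply/eq_in_map => p /okq[/andP[p_gt0 _] _].
  by rewrite /= word_val_power // -size_eq0 -lt0n.
rewrite all_map; apply/allP => -[u k] /okq[/= /andP[u_gt0 _] k_gt0].
by case: k k_gt0 => // k _; case: u u_gt0.
Qed.

End Reduction.

(** There is nothing to rearrange, so that words of length at least one vanish by
    an identity of degree one. *)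
Lemma reducible1 l (w : seq 'I_l) : w != [::] -> reducible 1 w.
Proof.
move=> w_n0; exists [::], (fun=> w); split=> // [|t pt].
  by rewrite enum_ordSl enum_ord0 /= cats0.
rewrite enum_ordSl enum_ord0 /= in pt *.
by rewrite (perm_small_eq _ pt) ?eqxx.
Qed.

(** * The constants *)

(** With 3^a <= 3n the powers of 3^a become powers of n: 60 * 24 * 2 <= 3^8, the
    two factors 3^a and 3^(9a) are at most (3n)^10, and the exponents of 3 add
    up to 8 + 27 + 10. *)
Lemma tiling_bound_simplified n l a : (0 < n)%N -> (3 ^ a <= 3 * n)%N ->
  (60 * n ^ 3 * (24 * (n ^ 2 * factor_bound n l a) *
     ((27 * n ^ 2) ^ 3) ^ (a + 3)) <= 3 ^ 45 * l * n ^ (12 * a + 35))%N.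
Proof.
move=> n_gt0 le_a; rewrite /factor_bound.
have e1 : ((3 * n ^ 6) ^ a = 3 ^ a * (n ^ a) ^ 6)%N.
  by rewrite expnMn expnAC.
have e2 : (((27 * n ^ 2) ^ 3) ^ (a + 3) =
    3 ^ 27 * n ^ 18 * ((3 ^ a) ^ 9 * (n ^ a) ^ 6))%N.
  have -> : ((27 * n ^ 2) ^ 3 = 3 ^ 9 * n ^ 6)%N by rewrite expnMn -!expnM.
  rewrite expnMn !expnD -!expnM ![(a * _)%N]mulnC.
  by move: (3 ^ _)%N (n ^ _)%N (3 ^ (9 * a))%N (n ^ (6 * a))%N; clear; lia.
have -> : (60 * n ^ 3 * (24 * (n ^ 2 * (2 * n ^ 2 * l * (3 * n ^ 6) ^ a)) *
    ((27 * n ^ 2) ^ 3) ^ (a + 3)) =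
    60 * 24 * 2 * 3 ^ 27 * l * n ^ (12 * a + 25) * (3 ^ a) ^ 10)%N.
  rewrite e1 e2 (_ : n ^ (12 * a + 25) =
      n ^ 3 * n ^ 2 * n ^ 2 * n ^ 18 * ((n ^ a) ^ 6 * (n ^ a) ^ 6))%N; last first.
    by rewrite -!expnM -!expnD; congr (n ^ _)%N; clear; lia.
  rewrite (expnS (3 ^ a) 9).
  move: (3 ^ 27)%N (3 ^ a)%N ((3 ^ a) ^ 9)%N ((n ^ a) ^ 6)%N => c u u9 v.
  by move: (n ^ 3)%N (n ^ 2)%N (n ^ 18)%N => n3 n2 n18; clear; ring.
apply: leq_trans (_ : 3 ^ 8 * 3 ^ 27 * l * n ^ (12 * a + 25) * (3 * n) ^ 10 <= _)%N.
  apply: leq_mul; last by rewrite leq_exp2r.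
  by do 3![rewrite leq_mul2r; apply/orP; right].
rewrite expnMn (_ : 12 * a + 35 = 12 * a + 25 + 10)%N ?expnD -?addnA //.
rewrite (_ : 45 = 8 + 27 + 10)%N // !expnD.
move: (3 ^ 8)%N (3 ^ 27)%N (3 ^ 10)%N (n ^ 10)%N => b c u v.
by rewrite leq_eqVlt; apply/orP; left; apply/eqP; clear; ring.
Qed.

Section RealBound.
Variable R : realType.

Lemma ln3_gt0 : 0 < ln 3 :> R.
Proof. by rewrite ln_gt0 // ltr1n. Qed.

(** This is 3^5 <= 4^4. It gives E2 >= 47 = 35 + 12, where 12 compensates for
    the rounding of log_3 n to the next integer. *)
Lemma log3_4_ge : 5 / 4 <= log3 4 :> R.
Proof.
rewrite /log3 ler_pdivlMr ?ln3_gt0 // mulrAC ler_pdivrMr //.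
have -> : 5 * ln 3 = ln (3 ^+ 5) :> R by rewrite lnXn // mulr_natl.
have -> : ln 4 * 4 = ln (4 ^+ 4) :> R by rewrite lnXn // mulr_natr.
by rewrite ler_ln ?posrE ?exprn_gt0 // -!natrX ler_nat.
Qed.

Lemma E1_ge : 3 ^+ 45 <= E1 R.
Proof.
apply: le_trans (_ : 4 ^+ 36 <= _).
  rewrite (exprM _ 5 9) (exprM _ 4 9) lerXn2r ?nnegrE ?exprn_ge0 //.
  by rewrite -!natrX ler_nat.
rewrite -powR_mulrn // /E1 ler_powR ?ler1n //.
by have := log3_4_ge; lra.
Qed.

Lemma Phi_ge0 n l : 0 <= Phi R n l.
Proof. by rewrite /Phi !mulr_ge0 ?powR_ge0. Qed.

Lemma Phi_ge n l a : (1 < n)%N -> (3 ^ a <= 3 * n)%N ->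
  (3 ^ 45 * l * n ^ (12 * a + 35))%N%:R <= Phi R n l.
Proof.
move=> n_gt1 le_a; have n1 : 1 <= n%:R :> R by rewrite ler1n ltnW.
have le_log : a%:R <= 1 + log3 n%:R :> R.
  rewrite /log3 -lerBlDl ler_pdivlMr ?ln3_gt0 // mulrBl mul1r lerBlDl.
  have -> : a%:R * ln 3 = ln (3 ^+ a) :> R by rewrite lnXn // mulr_natl.
  rewrite -lnM ?posrE ?ltr0n ?(ltnW n_gt1) //.
  by rewrite -natrX -natrM ler_ln ?posrE ?ltr0n ?expn_gt0 ?muln_gt0 ?ler_nat ?(ltnW n_gt1).
rewrite /Phi natrM (natrM _ (3 ^ 45) l); apply: ler_pM; rewrite ?mulr_ge0 ?ler0n //.
  by rewrite ler_wpM2r ?ler0n // (natrX _ 3 45) E1_ge.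
rewrite natrX -powR_mulrn ?ler0n // ler_powR // natrD natrM /E2.
by have := log3_4_ge; lra.
Qed.

End RealBound.

Lemma least_nat (P : nat -> Prop) h : P h ->
  exists m, [/\ P m, forall h', P h' -> (m <= h')%N & (m <= h)%N].
Proof.
move=> Ph; have exP : exists m, `[< P m >] by exists h; apply/asboolP.
case: (ex_minnP exP) => m /asboolP Pm m_min; exists m; split=> // [h' /asboolP|].
  exact: m_min.
by apply: m_min; apply/asboolP.
Qed.

Theorem mainTheorem2 (R : realType) (n l : nat) (n_gt0 : (0 < n)%N)
    (l_gt0 : (0 < l)%N) (K : fieldType) (A : lmodType K)
    (mul : {bilinear A -> A -> A}) (mulA : associative mul)
    (a : 'I_l -> A) (gen_a : generates mul a)
    (f : {malg K[{fmonom nat}]}) (f_id : polynomial_identity mul f)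
    (f_adm : admissible f) (f_deg : ncpoly_degree f = n) :
  exists h : nat,
    has_height mul a (short_words n l) h /\ h%:R <= Phi R n l.
Proof.
have [cs [cs_perm cs_id]] := multilinear_identity mulA f_id f_adm f_deg.
suff [H H_height le_H] :
    exists2 H : nat, height_at_most mul a (short_words n l) H & H%:R <= Phi R n l.
  have [h [h_height h_min le_h]] := least_nat H_height.
  by exists h; split=> //; apply: le_trans le_H; rewrite ler_nat.
have reduce := height_of_irreducible mulA n_gt0 cs_perm cs_id.
have [n_le1|n_gt1] := leqP n 1.
  exists 0%N; last exact: Phi_ge0.
  apply: reduce => w w_n0 []; have -> : n = 1%N by apply/anti_leq/andP.
  exact: reducible1.
pose e := up_log 3 n.
have e_ge : (n <= 3 ^ e)%N by apply: up_logP.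
have e_le : (3 ^ e <= 3 * n)%N.
  have e_gt0 : (0 < e)%N by rewrite up_log_gt0.
  rewrite -(prednK e_gt0) expnS leq_pmul2l // ltnW //.
  by have /andP[] := up_log_bounds (isT : (1 < 3)%N) n_gt1.
exists (3 ^ 45 * l * n ^ (12 * e + 35))%N; last exact: Phi_ge.
apply: reduce => w w_n0 irr.
have undivided : ~ divided (text w) (size w) n.
  by move=> dw; apply: irr; apply: divided_reducible.
have letters i : (i < size w)%N -> (text w i < l)%N by apply: text_lt.
have [ps tps sz_ps] := tiling_bound n_gt1 l_gt0 e_ge undivided letters.
apply: (tiling_height mulA a w_n0 tps).
exact: leq_trans sz_ps (tiling_bound_simplified l n_gt0 e_le).
Qed.
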